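(* Let $(G_i)_{i\in I}$ be groups with a common finite subgroup $A$, let $G=\ast_{A}G_{i}$ be their amalgamated free product over $A$, and assume $A$ is normal (in $G$). Let $T$ be the Bass–Serre tree described in the context, with the natural action of $G$. If $H$ and $K$ are tame subgroups of $G$ (with respect to $T$), then $H\cap K$ is tame and $$\overline{C}_{T}(H\cap K)\leq 2\cdot \theta \cdot |A\cap HK|\cdot\overline{C}_{T}(H)\cdot\overline{C}_{T}(K),$$ where $\theta=\max\{\theta(G_{i}/A)\,:\,i\in I\}$.
   Context: The tree of groups: a central vertex $u_0$ with vertex group $A$, and for each $i\in I$ an edge $e_i=[u_0,u_i]$ with edge group $A$ and vertex group $G_i$ at $u_i$; its fundamental group is $G$ and $T$ is its universal (Bass–Serre) tree. For a group $\Gamma$, $a_3(\Gamma)=\min\{|\Delta|\,:\,\Delta\le\Gamma,\ |\Delta|\ge3\}$ and $\theta(\Gamma)=\frac{a_3(\Gamma)}{a_3(\Gamma)-2}\in[1,3]$, with $\frac{\infty}{\infty-2}=1$. An element is hyperbolic if it fixes no vertex of $T$; for $H$ containing one, $T_H$ is the minimal $H$-invariant subtree. $H$ is tame if it fixes a vertex, or contains a hyperbolic element and $T_H/H$ is finite. A vertex $v$ is $H$-degenerate if $H_v=H_e$ for some edge $e$ with initial vertex $v$; then $[v]_H$ is degenerate in $T/H$. $C_T(H)=r(T/H)+|V_{ndeg}(T/H)|$ if $H$ contains a hyperbolic element (rank of fundamental group of $T/H$ plus the number of non-degenerate vertices), $C_T(H)=1$ otherwise; $\overline{C}_T(H)=\max\{C_T(H)-1,0\}$.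 *)

(* Defs.v *)
From Stdlib Require Import Reals List Arith ClassicalEpsilon.
Import ListNotations.
Set Implicit Arguments.
Unset Strict Implicit.

Record Group := mkGroup {
  gT :> Type;
  gmul : gT -> gT -> gT;
  gone : gT;
  ginv : gT -> gT;
  gmulA : forall x y z, gmul x (gmul y z) = gmul (gmul x y) z;
  gmul1 : forall x, gmul gone x = x;
  gmulV : forall x, gmul (ginv x) x = gone }.

Arguments gmul {g}.
Arguments gone {g}.
Arguments ginv {g}.

Definition subgroup (G : Group) (S : G -> Prop) : Prop :=
  S gone /\ (forall x y, S x -> S y -> S (gmul x y)) /\ (forall x, S x -> S (ginv x)).

Definition normal (G : Group) (A : G -> Prop) : Prop :=
  forall g a, A a -> A (gmul (ginv g) (gmul a g)).

Definition setI (X : Type) (S T : X -> Prop) : X -> Prop := fun x => S x /\ T x.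

Definition setM (G : Group) (H K : G -> Prop) : G -> Prop :=
  fun x => exists h k, H h /\ K k /\ x = gmul h k.

Definition card_is (X : Type) (S : X -> Prop) (n : nat) : Prop :=
  exists l : list X, NoDup l /\ length l = n /\ (forall x, In x l <-> S x).

Definition finite_set (X : Type) (S : X -> Prop) : Prop := exists n, card_is S n.

(* |S| for a finite set S (unspecified if S is infinite) *)
Definition card (X : Type) (S : X -> Prop) : nat := epsilon (inhabits 0) (card_is S).

Definition ncls (X : Type) (R : X -> X -> Prop) (S : X -> Prop) (n : nat) : Prop :=
  exists l : list X, length l = n /\ (forall x, In x l -> S x) /\
    ForallOrdPairs (fun a b => ~ R a b) l /\
    (forall x, S x -> exists y, In y l /\ R y x).

Record STree := mkSTree {
  V : Type;
  E : Type;
  src : E -> V;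
  erev : E -> E;
  rev_invol : forall e, erev (erev e) = e;
  rev_nofix : forall e, erev e <> e }.

Arguments src {s}.
Arguments erev {s}.

Definition tgt (T : STree) (e : E T) : V T := src (erev e).

(* walk in the graph whose vertices are classes of Rv and whose edges are
   the edges satisfying F (edges given by representatives):
   gwalk Rv F x p y  ==  p is a walk from [x] to [y] *)
Fixpoint gwalk (T : STree) (Rv : V T -> V T -> Prop) (F : E T -> Prop)
  (x : V T) (p : list (E T)) (y : V T) : Prop :=
  match p with
  | [] => Rv x y
  | e :: p' => F e /\ Rv x (src e) /\ gwalk Rv F (tgt e) p' y
  end.

Fixpoint greduced (T : STree) (Re : E T -> E T -> Prop) (p : list (E T)) : Prop :=
  match p with
  | e :: ((e' :: _) as p') => ~ Re e' (erev e) /\ greduced Re p'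
  | _ => True
  end.

Definition is_tree (T : STree) : Prop :=
  (forall x y : V T, exists p, gwalk (@eq _) (fun _ => True) x p y) /\
  (forall (x : V T) p, gwalk (@eq _) (fun _ => True) x p x ->
     greduced (T := T) (@eq _) p -> p = []).

Record Action (G : Group) (T : STree) := mkAction {
  actV : G -> V T -> V T;
  actE : G -> E T -> E T;
  actV1 : forall v, actV gone v = v;
  actVM : forall g h v, actV (gmul g h) v = actV g (actV h v);
  actE1 : forall e, actE gone e = e;
  actEM : forall g h e, actE (gmul g h) e = actE g (actE h e);
  act_src : forall g e, src (actE g e) = actV g (src e);
  act_rev : forall g e, erev (actE g e) = actE g (erev e) }.

Arguments actV {G T}.
Arguments actE {G T}.

Section ActionDefs.
Variables (G : Group) (T : STree) (a : Action G T).

Definition vH (H : G -> Prop) (v w : V T) : Prop := exists h, H h /\ actV a h v = w.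
Definition eH (H : G -> Prop) (e f : E T) : Prop := exists h, H h /\ actE a h e = f.

Definition fixes_vertex (H : G -> Prop) : Prop :=
  exists v, forall h, H h -> actV a h v = v.

Definition hyperbolic (g : G) : Prop := forall v, actV a g v <> v.

Definition has_hyperbolic (H : G -> Prop) : Prop := exists h, H h /\ hyperbolic h.

Definition subtree (W : V T -> Prop) : Prop :=
  (exists v, W v) /\
  (forall x y, W x -> W y ->
     exists p, gwalk (@eq _) (fun e => W (src e) /\ W (tgt e)) x p y).

Definition H_invariant (H : G -> Prop) (W : V T -> Prop) : Prop :=
  forall h v, H h -> W v -> W (actV a h v).

Definition min_inv_subtree (H : G -> Prop) (W : V T -> Prop) : Prop :=
  subtree W /\ H_invariant H W /\
  (forall W', subtree W' -> H_invariant H W' -> (forall v, W' v -> W v) ->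
     forall v, W v -> W' v).

Definition tame (H : G -> Prop) : Prop :=
  fixes_vertex H \/
  (has_hyperbolic H /\
   exists W, min_inv_subtree H W /\
     (exists n, ncls (vH H) W n) /\
     (exists m, ncls (eH H) (fun e => W (src e) /\ W (tgt e)) m)).

Definition degenerate (H : G -> Prop) (v : V T) : Prop :=
  exists e, src e = v /\
    forall h, H h -> (actV a h v = v <-> actE a h e = e).

(* r(T/H) = r : there is a spanning tree of T/H (given by an H-invariant,
   erev-closed set F of edges of T) whose complement consists of exactly
   r geometric edges (i.e. 2r oriented edges) of T/H. *)
Definition rank_is (H : G -> Prop) (r : nat) : Prop :=
  exists F : E T -> Prop,
    (forall h e, H h -> F e -> F (actE a h e)) /\
    (forall e, F e -> F (erev e)) /\
    (forall x y, exists p, gwalk (vH H) F x p y) /\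
    (forall x p, gwalk (vH H) F x p x -> greduced (eH H) p -> p = []) /\
    ncls (eH H) (fun e => ~ F e) (2 * r).

Definition rankTH (H : G -> Prop) : nat := epsilon (inhabits 0) (rank_is H).

Definition n_nondeg (H : G -> Prop) : nat :=
  epsilon (inhabits 0) (ncls (vH H) (fun v => ~ degenerate H v)).

Definition C_T (H : G -> Prop) : nat :=
  if excluded_middle_informative (has_hyperbolic H)
  then rankTH H + n_nondeg H else 1.

(* \overline{C}_T(H) = max (C_T(H) - 1, 0)  (truncated subtraction) *)
Definition Cbar_T (H : G -> Prop) : nat := C_T H - 1.

End ActionDefs.

(* Subgroups of G_i / A correspond to subgroups D with A <= D <= G_i, and
   |D / A| = |D| / |A| (A finite).
   quot_sub_order A Gi D m : D / A is a subgroup of Gi / A of (finite) order m. *)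
Definition quot_sub_order (G : Group) (A Gi D : G -> Prop) (m : nat) : Prop :=
  subgroup D /\ (forall x, A x -> D x) /\ (forall x, D x -> Gi x) /\
  card_is D (m * card A).

(* a3_is A Gi a : a = a_3(Gi / A), None standing for infinity *)
Definition a3_is (G : Group) (A Gi : G -> Prop) (a : option nat) : Prop :=
  match a with
  | Some n => 3 <= n /\ (exists D, quot_sub_order A Gi D n) /\
              (forall D m, quot_sub_order A Gi D m -> 3 <= m -> n <= m)
  | None => forall D m, quot_sub_order A Gi D m -> m < 3
  end.

Definition a3 (G : Group) (A Gi : G -> Prop) : option nat :=
  epsilon (inhabits None) (a3_is A Gi).

Definition theta_of (a : option nat) : R :=
  match a with
  | Some n => (INR n / (INR n - 2))%R
  | None => 1%R
  end.

Definition theta_max (G : Group) (I : Type) (A : G -> Prop) (Gs : I -> G -> Prop) : R :=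
  epsilon (inhabits 1%R)
    (fun t => (exists i, theta_of (a3 A (Gs i)) = t) /\
              (forall i, (theta_of (a3 A (Gs i)) <= t)%R)).

(* Main.v *)
(* Since [A] is normal, it is the kernel of the action, so that edge stabilizers
   in [G / A] are trivial. For a subgroup [H] with a hyperbolic element, counting
   edges in a spanning tree of [T/H] gives
   [2 * Cbar_T H = sum over vertices v of T_H/H of c(v)], where [c(v)] is the degree
   of [v] in [T_H/H], minus 2 if [v] is degenerate. The map from [T_L/L] to
   [T_H/H x T_K/K], [L = H :&: K], has at most [|A :&: HK|] edges in each fiber, so
   it is enough to bound the sum of [c] over the vertices above a pair [(v, w)] by
   [theta * |A :&: HK| * c(v) * c(w)]. If [v] or [w] is non-degenerate, counting
   edges does this. If both are degenerate, the edges at [v] and [w] are finite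
   subsets [X], [Y] of [G_i / A], and the bound says that the number [r(g)] of
   ways to write [g] as a product from [X] and [Y^-1] satisfies
   [sum over g of max (r(g) - 2) 0 <= theta * (|X| - 2) * (|Y| - 2)].
   The difference of the two sides is submodular in [X], so it is minimal on a set
   that meets each of its distinct translates in at most one point, and for such
   a set the inequality can be checked by counting pairs. *)

From Stdlib Require Import Reals Lra List ClassicalEpsilon.
From HB Require Import structures.
From mathcomp Require Import ssreflect ssrfun ssrbool eqtype ssrnat seq bigop.
From mathcomp Require Import boolp zify.
Require Import Defs.
Set Implicit Arguments.
Unset Strict Implicit.
Unset Printing Implicit Defensive.


(** The constant theta enters through the left stabilizer [S] of a minimizing set [X]. If
    [|S| >= 3], the crude bound [|X| * (|Y| - 2)] suffices, because [|X| >= |S|] gives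
    [|X| <= theta * (|X| - 2)]. If [|S| <= 2], the inequality holds already with constant 1: for
    [c <> 1] at most [|S|] elements [x] have both [x] and [x c] in [X], so the sum of [r (r - 1)] is
    at most [|S| |Y| (|Y| - 1)], and [6 (r - 2) <= r (r - 1)]. This comparison needs [|Y| <= |X|],
    which is arranged by inverting the products. On the tree side the obstacle is that the rank is
    defined by a spanning tree of all of [T/H], which may be infinite. Edges off [T_H] become
    bridges of [T/H], so every spanning tree contains them and the count takes place in the finite
    graph [T_H/H]. Theta is carried as a fraction [p / q], which keeps all counting in [nat]. *)

(* Opaque, so that simplification does not unfold boolean equality. *)
Fact classical_eq (X : Type) : hasDecEq X.
Proof. exact: gen_eqMixin. Qed.

HB.instance Definition _ (G : Group) := classical_eq (gT G).
HB.instance Definition _ (T : STree) := classical_eq (V T).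
HB.instance Definition _ (T : STree) := classical_eq (E T).

(** * Enumerations and equivalence classes *)

Lemma ex_minimal (X : Type) (P : X -> Prop) (m : X -> nat) :
  (exists x, P x) -> exists2 x, P x & forall y, P y -> m x <= m y.
Proof.
move=> [x0 Px0].
have ex : exists n, `[< exists2 x, P x & m x = n >] by exists (m x0); apply/asboolP; exists x0.
case: (ex_minnP ex) => n /asboolP [x Px mx] H.
by exists x => // y Py; rewrite mx; apply: H; apply/asboolP; exists y.
Qed.

Definition enumerates (X : eqType) (S : X -> Prop) (l : seq X) :=
  uniq l /\ forall x, x \in l <-> S x.

Section Enumerates.
Variable X : eqType.
Implicit Types (S : X -> Prop) (l : seq X).

Lemma InP (x : X) l : In x l <-> x \in l.
Proof.
elim: l => [|a l IH] //=; rewrite inE IH; split.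
  by case=> [->|->]; rewrite ?eqxx ?orbT.
by case/predU1P => [->|]; [left | right].
Qed.

Lemma NoDupP l : NoDup l <-> uniq l.
Proof.
elim: l => [|a l IH] /=; first by split => // _; constructor.
split.
  by move=> /NoDup_cons_iff [al /IH ->]; rewrite andbT; apply/negP => /InP.
by case/andP => al /IH nd; constructor => // /InP; apply/negP.
Qed.

Lemma card_isP S n : card_is S n <-> exists2 l, enumerates S l & size l = n.
Proof.
split.
  move=> [l [/NoDupP ul [<- lS]]]; exists l => //; split=> // x.
  by rewrite -lS InP.
move=> [l [ul lS] <-]; exists l; split; first exact/NoDupP.
by split=> // x; rewrite InP lS.
Qed.

Lemma enumerates_size S l l' : enumerates S l -> enumerates S l' -> size l = size l'.
Proof.
move=> [u s] [u' s']; apply/perm_size; apply: uniq_perm => // x.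
by apply/idP/idP => [/s/s'|/s'/s].
Qed.

Lemma card_enum S l : enumerates S l -> card S = size l.
Proof.
move=> H; have: card_is S (card S).
  by apply: epsilon_spec; exists (size l); apply/card_isP; exists l.
by case/card_isP => l' H' <-; apply: enumerates_size H' H.
Qed.

Lemma enumerates_bounded S l : (forall x, S x -> x \in l) -> exists l', enumerates S l'.
Proof.
move=> Sl; exists [seq x <- undup l | `[< S x >]]; split.
  exact/filter_uniq/undup_uniq.
move=> x; rewrite mem_filter mem_undup; split; first by case/andP => /asboolP.
by move=> Sx; apply/andP; split; [apply/asboolP | apply: Sl].
Qed.

End Enumerates.

Definition equiv (X : Type) (R : X -> X -> Prop) :=
  [/\ forall x, R x x, forall x y, R x y -> R y x & forall x y z, R x y -> R y z -> R x z].

(** Related points have the same predicate [R x], hence the same choice by [epsilon]; classes can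
    then be counted as fixed points of [rep R]. *)
Definition rep (X : Type) (R : X -> X -> Prop) (x : X) : X := epsilon (inhabits x) (R x).

Definition reps (X : Type) (R : X -> X -> Prop) (S : X -> Prop) (x : X) :=
  S x /\ rep R x = x.

Section Classes.
Variables (X : eqType) (R : X -> X -> Prop).
Hypothesis eqR : equiv R.

Lemma rep_rel x : R x (rep R x).
Proof. by apply: epsilon_spec; exists x; case: eqR. Qed.

Lemma rep_eq x y : R x y -> rep R x = rep R y.
Proof.
case: eqR => r s t xy; rewrite /rep.
have -> : R x = R y by apply/funext => z; apply/propext; split; eauto.
by congr epsilon; apply: Prop_irrelevance.
Qed.

Lemma rep_inj x y : rep R x = rep R y -> R x y.
Proof.
case: eqR => r s t e; apply: t (rep_rel x) _; rewrite e; apply: s; exact: rep_rel.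
Qed.

Lemma rep_rep x : rep R (rep R x) = rep R x.
Proof. by apply/esym/rep_eq/rep_rel. Qed.

Lemma reps_rep (S : X -> Prop) x : (forall y z, S y -> R y z -> S z) -> S x -> reps R S (rep R x).
Proof. by move=> cl Sx; split; [apply: cl (rep_rel x) | rewrite rep_rep]. Qed.

(** Reduces every count of classes to the size of a duplicate-free list of canonical
    representatives. *)
Lemma nclsP (S : X -> Prop) n : (forall x y, S x -> R x y -> S y) ->
  ncls R S n <-> exists2 l, enumerates (reps R S) l & size l = n.
Proof.
case: (eqR) => r s t clS; split.
  move=> [l [sl [lS [nR cov]]]]; exists (map (rep R) l); last by rewrite size_map.
  split; last first.
    move=> x; split.
      by case/mapP => y /InP/lS Sy ->; exact: reps_rep.
    move=> [Sx ex]; have [y [/InP yl yx]] := cov _ Sx.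
    by apply/mapP; exists y => //; rewrite (rep_eq yx).
  elim: nR {sl lS cov} => [//|a l' Ha _ IH] /=; rewrite IH andbT.
  apply/negP => /mapP [y /InP yl' /rep_inj ay].
  by move/Forall_forall: Ha => /(_ _ yl').
move=> [l [ul lS] <-]; exists l; split=> //; split; first by move=> x /InP/lS [].
split; last first.
  move=> x Sx; exists (rep R x); split; last exact/s/rep_rel.
  by apply/InP/lS; exact: reps_rep.
have: forall x, x \in l -> rep R x = x by move=> x /lS [].
elim: l {lS} ul => [|a l IH] /= ul lr; first by constructor.
case/andP: ul => al ul; constructor; last by apply: IH => // x xl; apply: lr; rewrite inE xl orbT.
apply/Forall_forall => x /InP xl /rep_eq.
rewrite !lr ?inE ?eqxx ?xl ?orbT // => e; by rewrite e xl in al.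
Qed.

Lemma ncls_unique (S : X -> Prop) n n' : (forall x y, S x -> R x y -> S y) ->
  ncls R S n -> ncls R S n' -> n = n'.
Proof. by move=> cl /(nclsP _ cl) [l Hl <-] /(nclsP _ cl) [l' Hl' <-]; apply: enumerates_size Hl Hl'. Qed.

End Classes.

(** * Elementary group identities *)

Section GroupLemmas.
Variable G : Group.
Implicit Types x y z : G.

Lemma gmulVg x y : gmul (ginv x) (gmul x y) = y.
Proof. by rewrite gmulA gmulV gmul1. Qed.

Lemma gmulgV x : gmul x (ginv x) = gone.
Proof.
by rewrite -[LHS]gmul1 -{1}(gmulV (ginv x)) -gmulA (gmulVg x) gmulV.
Qed.

Lemma gmulg1 x : gmul x gone = x.
Proof. by rewrite -(gmulV x) gmulA gmulgV gmul1. Qed.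

Lemma gmulKg x y : gmul x (gmul (ginv x) y) = y.
Proof. by rewrite gmulA gmulgV gmul1. Qed.

Lemma gmul_inj x y z : gmul x y = gmul x z -> y = z.
Proof. by move=> e; rewrite -(gmulVg x y) e gmulVg. Qed.

Lemma gmul_injr x y z : gmul y x = gmul z x -> y = z.
Proof. by move=> e; rewrite -(gmulg1 y) -(gmulg1 z) -(gmulgV x) !gmulA e. Qed.

Lemma ginv_inv x : ginv (ginv x) = x.
Proof. by apply: (@gmul_inj (ginv x)); rewrite gmulgV gmulV. Qed.

Lemma ginv_mul x y : ginv (gmul x y) = gmul (ginv y) (ginv x).
Proof. by apply: (@gmul_inj (gmul x y)); rewrite gmulgV -gmulA gmulKg gmulgV. Qed.

Lemma ginv1 : ginv gone = gone :> G.
Proof. by rewrite -[LHS]gmul1 gmulgV. Qed.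

Lemma ginv_inj : injective (@ginv G).
Proof. by move=> x y e; rewrite -(ginv_inv x) e ginv_inv. Qed.

End GroupLemmas.

(** * Sums and counting over lists *)

Lemma leq_sum_seq (X : eqType) (s : seq X) (F F' : X -> nat) :
  (forall x, x \in s -> F x <= F' x) -> \sum_(x <- s) F x <= \sum_(x <- s) F' x.
Proof. by move=> H; rewrite !big_seq; apply: leq_sum. Qed.

Lemma sum_const_seq (X : Type) (s : seq X) n : \sum_(x <- s) n = n * size s.
Proof. by rewrite big_const_seq count_predT iter_addn_0. Qed.

Lemma leq_sum_support (X : eqType) (s s' : seq X) (F : X -> nat) : uniq s -> uniq s' ->
  (forall x, x \in s -> 0 < F x -> x \in s') -> \sum_(x <- s) F x <= \sum_(x <- s') F x.
Proof.
move=> us us' H.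
have E0 (l : seq X) : \sum_(x <- l) F x = \sum_(x <- [seq x <- l | 0 < F x]) F x.
  rewrite big_filter [RHS]big_mkcond /=; apply: eq_bigr => x _; by case: posnP.
rewrite E0 (E0 s').
have -> : \sum_(x <- [seq x <- s' | 0 < F x]) F x =
   \sum_(x <- [seq x <- s' | 0 < F x] | x \in s) F x
   + \sum_(x <- [seq x <- s' | 0 < F x] | x \notin s) F x by exact: bigID.
apply: leq_trans (leq_addr _ _); rewrite -(big_filter _ (mem s)).
rewrite (perm_big [seq x <- [seq x <- s' | 0 < F x] | x \in s]) //=.
apply: uniq_perm; rewrite ?filter_uniq // => x; rewrite !mem_filter.
by case: (posnP (F x)) => //= Fx; case xs: (x \in s) => //=; rewrite (H _ xs Fx).
Qed.

Lemma leq_count_inj (X Y : eqType) (a : pred X) (s : seq X) (t : seq Y) (f : X -> Y) :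
  uniq s -> {in s &, forall x y, a x -> a y -> f x = f y -> x = y} ->
  (forall x, x \in s -> a x -> f x \in t) -> count a s <= size t.
Proof.
move=> us finj ft; rewrite -size_filter -(size_map f); apply: uniq_leq_size.
  rewrite map_inj_in_uniq ?filter_uniq // => x y; rewrite !mem_filter.
  by move=> /andP[ax xs] /andP[ay ys]; apply: finj.
by move=> _ /mapP[x + ->]; rewrite mem_filter => /andP[ax xs]; apply: ft.
Qed.

Lemma ltn_count (X : eqType) (a b : pred X) (s : seq X) x :
  subpred a b -> x \in s -> b x -> ~~ a x -> count a s < count b s.
Proof.
move=> ab xs bx nax; have := count_predC a (filter b s); rewrite size_filter => <-; rewrite !count_filter.
have -> : count a s = count (predI a b) s.
  by apply: eq_count => y /=; case ay: (a y) => //; rewrite ab.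
by rewrite -addn1 leq_add2l -has_count; apply/hasP; exists x => //=; rewrite nax.
Qed.

(** * Representations of group elements as products *)

Section ProductSets.
Variable G : Group.
Implicit Types (X Y B U : seq G) (g x b : G).

(** [B] plays the role of the inverses of [Y]. A factorization [g = x b] is counted by its right
    factor. *)
Definition nrep X B g := count (fun b => gmul g (ginv b) \in X) B.
Definition prods X B := undup [seq gmul x b | x <- X, b <- B].
(* The truncated subtraction makes each term [max (nrep - 2) 0]. *)
Definition excess X B := \sum_(g <- prods X B) (nrep X B g - 2).

Lemma mem_prods X B x b : x \in X -> b \in B -> gmul x b \in prods X B.
Proof. by move=> xX bB; rewrite mem_undup; apply/allpairsP; exists (x, b). Qed.

Lemma nrep_map_inv X B g : nrep X (map ginv B) g = count (fun b => gmul g b \in X) B.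
Proof. by rewrite /nrep count_map; apply: eq_count => b /=; rewrite ginv_inv. Qed.

Lemma nrep_gt0 X B g : 0 < nrep X B g -> g \in prods X B.
Proof.
rewrite -has_count => /hasP [b bB xX].
by rewrite -(gmulg1 g) -(gmulV b) gmulA mem_prods.
Qed.

Lemma nrep_size X B g : nrep X B g <= size B.
Proof. exact: count_size. Qed.

Lemma nrep_size_l X B g : uniq B -> nrep X B g <= size X.
Proof.
move=> uB; apply: (leq_count_inj (f := fun b => gmul g (ginv b))) => //.
by move=> b b' _ _ _ _ /gmul_inj /ginv_inj.
Qed.

Lemma leq_excess X B U : uniq U -> \sum_(g <- U) (nrep X B g - 2) <= excess X B.
Proof.
move=> uU; apply: leq_sum_support => //; first exact: undup_uniq.
by move=> g _ gt; apply: nrep_gt0; lia.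
Qed.

Lemma sum_nrep X B U : uniq U -> \sum_(g <- U) nrep X B g <= size X * size B.
Proof.
move=> uU; rewrite /nrep.
under eq_bigr do rewrite -sum1_count big_mkcond.
rewrite exchange_big -sum_const_seq /=; apply: leq_sum => b _.
rewrite -big_mkcond sum1_count /=.
apply: (leq_count_inj (f := fun g => gmul g (ginv b))) => // x y _ _ _ _.
exact: gmul_injr.
Qed.

(** For [r <= |B|] one has [|B| * max (r - 2) 0 <= r * (|B| - 2)], and the numbers [r] sum to at
    most [|X| * |B|]. *)
Lemma excess_trivial X B : excess X B <= size X * (size B - 2).
Proof.
case: (posnP (size B)) => [/size0nil ->|b0].
  by rewrite /excess big1.
rewrite -(leq_pmul2l b0) /excess big_distrr /=.
apply: (@leq_trans (\sum_(g <- prods X B) nrep X B g * (size B - 2))).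
  by apply: leq_sum => g _; have := nrep_size X B g; nia.
rewrite -big_distrl /= mulnA leq_mul2r [size B * _]mulnC sum_nrep ?orbT //.
exact: undup_uniq.
Qed.

Lemma excess_translate g X B : excess X B <= excess (map (gmul g) X) B.
Proof.
apply: leq_trans (@leq_excess _ _ (map (gmul g) (prods X B)) _).
  rewrite big_map; apply: leq_sum => h _; rewrite leq_sub2r // /nrep.
  by apply: sub_count => b hb; rewrite -gmulA map_f.
rewrite map_inj_uniq ?undup_uniq // => x y; exact: gmul_inj.
Qed.

Lemma nrep_inv X B g : uniq B -> nrep X B g <= nrep (map ginv B) (map ginv X) (ginv g).
Proof.
move=> uB; rewrite /nrep count_map -(size_filter _ X).
apply: (leq_count_inj (f := fun b => gmul g (ginv b))) => //.
  by move=> b b' _ _ _ _ /gmul_inj /ginv_inj.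
move=> b bB gX; rewrite mem_filter gX andbT /= ginv_inv; apply/mapP; exists b => //.
by rewrite gmulA gmulV gmul1.
Qed.

(** Inverting [g = x b] exchanges the two factors, which allows the larger set to be placed on the
    left. *)
Lemma excess_inv X B : uniq B -> excess X B <= excess (map ginv B) (map ginv X).
Proof.
move=> uB; apply: leq_trans (@leq_excess _ _ (map ginv (prods X B)) _).
  by rewrite big_map; apply: leq_sum => h _; rewrite leq_sub2r // nrep_inv.
rewrite map_inj_uniq ?undup_uniq //; exact: ginv_inj.
Qed.

Definition capl X Y := [seq x <- X | x \in Y].
Definition cupl X Y := X ++ [seq y <- Y | y \notin X].

Lemma mem_cupl X Y x : (x \in cupl X Y) = (x \in X) || (x \in Y).
Proof. by rewrite mem_cat mem_filter; case: (x \in X). Qed.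

Lemma size_cap_cup X Y : uniq X -> uniq Y ->
  size (capl X Y) + size (cupl X Y) = size X + size Y.
Proof.
move=> uX uY; rewrite size_cat addnCA; congr addn.
have -> : size (capl X Y) = size (capl Y X).
  apply/perm_size/uniq_perm; rewrite ?filter_uniq // => x.
  by rewrite !mem_filter andbC.
by rewrite !size_filter count_predC.
Qed.

Lemma nrep_cap_cup X Y B g :
  nrep (capl X Y) B g + nrep (cupl X Y) B g = nrep X B g + nrep Y B g.
Proof.
rewrite /nrep -[RHS]count_predUI addnC; congr addn; apply: eq_count => b /=.
  by rewrite mem_cupl.
by rewrite mem_filter andbC.
Qed.

(** [nrep] is modular in its first set and [max (t - 2) 0] is convex in [t]; the values for
    intersection and union have the same sum as those for [X] and [Y] but lie further apart. *)
Lemma excess_cap_cup X Y B :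
  excess X B + excess Y B <= excess (capl X Y) B + excess (cupl X Y) B.
Proof.
pose U := undup (prods X B ++ prods Y B).
have uU : uniq U := undup_uniq _.
have sub Z : {subset Z <= X} \/ {subset Z <= Y} ->
    excess Z B <= \sum_(g <- U) (nrep Z B g - 2).
  move=> H; apply: leq_sum_support => //; first exact: undup_uniq.
  move=> g _ gt; have: has (fun b => gmul g (ginv b) \in Z) B by rewrite has_count -/(nrep _ _ _); lia.
  case/hasP => b bB gZ; rewrite mem_undup mem_cat -(gmulg1 g) -(gmulV b) gmulA.
  by case: H => /(_ _ gZ) H; rewrite (mem_prods H bB) ?orbT.
apply: leq_trans (leq_add (sub X _) (sub Y _)) _; [by left| by right |].
apply: leq_trans (leq_add (leq_excess _ _ uU) (leq_excess _ _ uU)).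
rewrite -!big_split /=; apply: leq_sum => g _.
have := nrep_cap_cup X Y B g.
have : nrep (capl X Y) B g <= nrep X B g by apply: sub_count => b; rewrite mem_filter => /andP[].
have : nrep (capl X Y) B g <= nrep Y B g by apply: sub_count => b; rewrite mem_filter => /andP[].
lia.
Qed.

(** Double counting of triples [(g, b, b')] with [b <> b'] and both [g b^-1] and [g b'^-1] in
    [X]. *)
Lemma sum_nrep_pairs X B U n : uniq X -> uniq B -> uniq U ->
  (forall c, c <> gone -> count (fun x => gmul x c \in X) X <= n) ->
  \sum_(g <- U) nrep X B g * (nrep X B g).-1 <= n * (size B * (size B).-1).
Proof.
move=> uX uB uU H.
have E1 (a : pred G) b : b \in B -> a b -> count (fun b' => a b' && (b' != b)) B = (count a B).-1.
  move=> bB ab; have := count_predC (pred1 b) (filter a B).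
  rewrite size_filter !count_filter => <-.
  have -> : count (predI (pred1 b) a) B = 1.
    rewrite (@eq_count _ _ (pred1 b)) ?count_uniq_mem ?bB // => x /=.
    by case: eqP => // ->.
  by rewrite add1n /=; apply: eq_count => x /=; rewrite andbC.
have E2 g : nrep X B g * (nrep X B g).-1 =
    \sum_(b <- B) \sum_(b' <- B | b' != b) ((gmul g (ginv b) \in X) && (gmul g (ginv b') \in X)).
  rewrite {1}/nrep -sum1_count big_mkcond big_distrl /= [LHS]big_seq [RHS]big_seq.
  apply: eq_bigr => b bB; case: ifP => [gb|_]; last by rewrite big1.
  rewrite mul1n -(E1 (fun b => gmul g (ginv b) \in X) b bB gb) -sum1_count.
  rewrite big_mkcond [RHS]big_mkcond; apply: eq_bigr => b' _ /=.
  by case: (b' != b); case: (_ \in X).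
under eq_bigr do rewrite E2.
rewrite exchange_big /=.
have -> : n * (size B * (size B).-1) = \sum_(b <- B) (\sum_(b' <- B | b' != b) n).
  rewrite [RHS]big_seq; rewrite (eq_bigr (fun _ => n * (size B).-1)).
    by rewrite -big_seq sum_const_seq mulnA mulnAC.
  move=> b bB; rewrite big_const_seq iter_addn_0 -(count_predT B) -(E1 predT b) //.
apply: leq_sum => b _; rewrite exchange_big /=; apply: leq_sum => b' nb.
rewrite -(big_mkcond _ (fun _ => 1)) /= sum1_count.
(* With [x = g b'^-1] and [c = b' b^-1], the element [x c] is [g b^-1]; [b'] and [x] determine
   [g]. *)
apply: leq_trans (H (gmul b' (ginv b)) _); last first.
  move=> e; move: nb; apply/negP; rewrite negbK; apply/eqP.
  by rewrite -[b']gmulg1 -(gmulV b) gmulA e gmul1.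
rewrite -(size_filter _ X); apply: (leq_count_inj (f := fun g => gmul g (ginv b'))) => //.
  by move=> x y _ _ _ _; exact: gmul_injr.
move=> g _ /andP[gb gb']; rewrite mem_filter gb' andbT.
by rewrite -gmulA gmulVg.
Qed.

End ProductSets.

(** * The product inequality with constant [p / q] *)

Section ExcessBound.
Variables (G : Group) (D : G -> Prop) (p q : nat).
Hypothesis sD : subgroup D.
Hypothesis q_gt0 : 0 < q.
Hypothesis le_qp : q <= p.
(** In the application [D] is the image of a vertex group in [G / A] and [p / q] is theta. *)
Hypothesis big_subgroups : forall Q : seq G, uniq Q -> (forall x, x \in Q -> D x) ->
  subgroup (fun x => x \in Q) -> 3 <= size Q -> q * size Q <= p * (size Q - 2).

Definition inD (X : seq G) := uniq X /\ forall x, x \in X -> D x.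

Lemma inD_translate g X : D g -> inD X -> inD (map (gmul g) X).
Proof.
case: sD => _ [DM _] Dg [uX DX]; split.
  by rewrite map_inj_uniq // => x y; exact: gmul_inj.
by move=> _ /mapP[x xX ->]; apply: DM => //; exact: DX.
Qed.

Lemma inD_inv X : inD X -> inD (map ginv X).
Proof.
case: sD => _ [_ DV] [uX DX]; split; first by rewrite map_inj_uniq //; exact: ginv_inj.
by move=> _ /mapP[x xX ->]; apply: DV; exact: DX.
Qed.

Lemma inD_cap X Y : inD X -> inD Y -> inD (capl X Y).
Proof.
move=> [uX DX] _; split; first exact: filter_uniq.
by move=> x; rewrite mem_filter => /andP[_ /DX].
Qed.

Lemma inD_cup X Y : inD X -> inD Y -> inD (cupl X Y).
Proof.
move=> [uX DX] [uY DY]; split; last by move=> x; rewrite mem_cupl => /orP[/DX|/DY].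
rewrite cat_uniq uX filter_uniq // andbT /=; apply/hasPn => x.
by rewrite mem_filter => /andP[].
Qed.

Section Atom.
Variables X B : seq G.
Hypotheses (iX : inD X) (iB : inD B) (X3 : 3 <= size X) (B3 : 3 <= size B).
Hypothesis leBX : size B <= size X.
(** A translate of [X] that shares two points with [X] is [X] itself. *)
Hypothesis atom : forall g y z, D g -> y \in X -> z \in X -> y <> z ->
  gmul g y \in X -> gmul g z \in X -> forall x, x \in X -> gmul g x \in X.

Let x0 := head gone X.

Lemma x0X : x0 \in X.
Proof. by rewrite /x0; case: (X) X3 => //= a l _; rewrite inE eqxx. Qed.

(** The left stabilizer of [X]: such a [g] is determined by [g x0], which lies in [X], so the
    candidates [x x0^-1] form a finite list. *)
Definition stabl := [seq g <- map (fun x => gmul x (ginv x0)) X | all (fun x => gmul g x \in X) X].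

Lemma mem_stabl g : reflect (forall x, x \in X -> gmul g x \in X) (g \in stabl).
Proof.
rewrite mem_filter; apply: (iffP andP) => [[/allP]//|H].
split; first exact/allP.
apply/mapP; exists (gmul g x0); first by apply: H; exact: x0X.
by rewrite -gmulA gmulgV gmulg1.
Qed.

Lemma stabl_uniq : uniq stabl.
Proof.
case: iX => uX _; rewrite filter_uniq // map_inj_uniq // => x y; exact: gmul_injr.
Qed.

Lemma stabl_size : size stabl <= size X.
Proof. by rewrite size_filter (leq_trans (count_size _ _)) // size_map. Qed.

Lemma stablD g : g \in stabl -> D g.
Proof.
case: sD => _ [DM DV]; case: iX => _ DX.
rewrite mem_filter => /andP[_ /mapP[x xX ->]].
by apply: DM; [exact: DX | apply/DV/DX; exact: x0X].
Qed.

Lemma stabl_subgroup : subgroup (fun x => x \in stabl).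
Proof.
split; first by apply/mem_stabl => x; rewrite gmul1.
split.
  move=> x y /mem_stabl Hx /mem_stabl Hy; apply/mem_stabl => z zX.
  by rewrite -gmulA; apply/Hx/Hy.
move=> g /mem_stabl Hg; apply/mem_stabl => x xX.
case: iX => uX _.
have ug : uniq (map (gmul g) X) by rewrite map_inj_uniq // => a b; exact: gmul_inj.
have sub : {subset map (gmul g) X <= X} by move=> _ /mapP[y yX ->]; exact: Hg.
(* An injection of the finite set [X] into itself is onto, so [g^-1] stabilizes [X] too. *)
have [_ E] := uniq_min_size ug sub (eq_leq (esym (size_map _ _))).
by move: xX; rewrite -E => /mapP[y yX ->]; rewrite gmulVg.
Qed.

(** If [x], [x c], [y], [y c] all lie in [X], then [y x^-1] carries two points of [X] into [X],
    hence stabilizes it. Fixing [x] embeds the solutions [y] into the stabilizer. *)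
Lemma stabl_pairs c : c <> gone -> count (fun x => gmul x c \in X) X <= size stabl.
Proof.
move=> c1; case: (iX) => uX DX; case: (sD) => _ [DM DV].
have [/hasP[x xX xc]|no] := boolP (has (fun x => gmul x c \in X) X); last first.
  by move: no; rewrite has_count -leqNgt leqn0 => /eqP ->.
apply: (leq_count_inj (f := fun y => gmul y (ginv x))) => //.
  by move=> y z _ _ _ _; exact: gmul_injr.
move=> y yX yc; apply/mem_stabl; apply: (@atom _ x (gmul x c)) => //.
- by apply: DM; [exact: DX | apply/DV/DX].
- by rewrite -{1}(gmulg1 x) => /gmul_inj /esym.
- by rewrite -gmulA gmulV gmulg1.
- by rewrite -gmulA gmulVg.
Qed.

(** A group of order two acts freely on [X] by left multiplication; three points need at least two
    orbits, hence four points. *)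
Lemma stabl_two : size stabl = 2 -> 4 <= size X.
Proof.
move=> s2; have us := stabl_uniq; have [s1 [sM sV]] := stabl_subgroup.
have [t ts t1] : exists2 t, t \in stabl & t <> gone.
  move: s1 s2 us; case: stabl => [//|a [//|b [|//]]]; rewrite !inE => /orP[/eqP ->|/eqP ->] _ /=.
    by rewrite andbT inE => ab; exists b; rewrite ?inE ?eqxx ?orbT // => e; rewrite e eqxx in ab.
  by rewrite andbT inE => ab; exists a; rewrite ?inE ?eqxx ?orbT // => e; rewrite e eqxx in ab.
have tt : gmul t t = gone.
  apply: contrapT => tt1.
  have: uniq [:: gone; t; gmul t t].
    rewrite /= !inE !andbT negb_or; apply/andP; split; first apply/andP; try split; apply/eqP => //.
    - by move/esym.
    - by move/esym.
    - by rewrite -{1}(gmulg1 t) => /gmul_inj/esym.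
  move/(@uniq_leq_size _ _ stabl) => /=; rewrite s2 => H.
  suff: 3 <= 2 by []. apply: H => x; rewrite !inE => /or3P[]/eqP -> //; exact: sM.
have x0t : gmul t x0 <> x0.
  by rewrite -{2}(gmul1 x0) => /gmul_injr.
have [y yX /andP [y0 yt]] : exists2 y, y \in X & (y != x0) && (y != gmul t x0).
  apply: contrapT => no; have: size X <= size [:: x0; gmul t x0].
    apply: uniq_leq_size; first by case: iX.
    move=> y yX; rewrite !inE; apply/negPn/negP; rewrite negb_or => ny.
    by apply: no; exists y.
  by move: X3 => /=; lia.
have HX x : x \in X -> gmul t x \in X by move: x; apply/mem_stabl.
have: uniq [:: x0; gmul t x0; y; gmul t y].
  have n1 : x0 != gmul t x0 by apply/eqP => /esym.
  have n2 : x0 != gmul t y.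
    by apply/eqP => e; move: yt; rewrite e gmulA tt gmul1 eqxx.
  have n3 : gmul t x0 != gmul t y by apply/eqP => /gmul_inj e; rewrite e eqxx in y0.
  have n4 : y != gmul t y.
    by apply/eqP => e; apply: t1; apply: (@gmul_injr _ y); rewrite gmul1.
  by rewrite /= !inE !negb_or n1 n2 n3 n4 (eq_sym x0) y0 (eq_sym _ y) yt.
move/(@uniq_leq_size _ _ X); apply => x; rewrite !inE => /or4P[]/eqP -> //; try exact: HX.
- exact: x0X.
- by apply: HX; exact: x0X.
Qed.

Lemma excess_atom : q * excess X B <= p * ((size X - 2) * (size B - 2)).
Proof.
have triv := excess_trivial X B.
have ss := stabl_size.
case: (leqP 3 (size stabl)) => [s3|s2].
  have := big_subgroups stabl_uniq stablD stabl_subgroup s3 => H.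
  (* The inequality passes from the stabilizer to the larger [X], as each further element adds [q]
     on the left and [p >= q] on the right. *)
  have H2 : q * size X <= p * (size X - 2) by nia.
  by apply: leq_trans (leq_mul (leqnn q) triv) _; rewrite !mulnA leq_mul2r H2 orbT.
have [[uX _] [uB _]] := (iX, iB).
have P : \sum_(g <- prods X B) nrep X B g * (nrep X B g).-1 <= size stabl * (size B * (size B).-1).
  by apply: sum_nrep_pairs => //; [exact: undup_uniq | exact: stabl_pairs].
(* [r (r - 1) - 6 (r - 2) = (r - 3) (r - 4)] is nonnegative on integers; 6 is the best constant. *)
have P6 : 6 * excess X B <= size stabl * (size B * (size B).-1).
  apply: leq_trans P; rewrite /excess big_distrr /=; apply: leq_sum => g _.
  by case: (nrep X B g) => [|[|[|[|r]]]] //=; nia.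
suff: excess X B <= (size X - 2) * (size B - 2) by move=> H; apply: leq_mul.
have [s1|s_2] : size stabl <= 1 \/ size stabl = 2 by lia.
  have : 6 * excess X B <= size B * (size B).-1 by nia.
  move: (size X) (size B) (excess X B) X3 B3 leBX => k b f k3 b3 bk H.
  have [k' [b' [ek eb]]] : exists k' b', k = k' + 3 /\ b = b' + 3 by exists (k-3), (b-3); lia.
  subst; move: H; have -> : (b' + 3).-1 = b' + 2 by lia.
  have le1 : (b' + 1) * (b' + 1) <= (k' + 1) * (b' + 1) by rewrite leq_mul2r; lia.
  have -> : b' + 3 - 2 = b' + 1 by lia.
  have -> : k' + 3 - 2 = k' + 1 by lia.
  by nia.
(* For [b = 3] the count gives only [f <= 2], so [k >= 4] is essential. For [b >= 4] the inequality
   [2 b (b - 1) <= 6 (b - 2)^2] suffices, with equality at 4. *)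
have := stabl_two s_2; move: P6; rewrite s_2.
move: (size X) (size B) (excess X B) B3 leBX => k b f b3 bk H k4.
have [b_3|b4] : b = 3 \/ 4 <= b by lia.
  by subst; move: H => /=; lia.
have [k' [b' [ek eb]]] : exists k' b', k = k' + 4 /\ b = b' + 4 by exists (k-4), (b-4); lia.
subst; move: H; have -> : (b' + 4).-1 = b' + 3 by lia.
have le1 : (b' + 2) * (b' + 2) <= (k' + 2) * (b' + 2) by rewrite leq_mul2r; lia.
have -> : b' + 4 - 2 = b' + 2 by lia.
have -> : k' + 4 - 2 = k' + 2 by lia.
by nia.
Qed.

End Atom.

(* [pot X] is nonnegative and submodular in X; among its minimizers, one of
   minimal size meets its translates in at most one point or coincides with them. *)
Lemma excess_bound X B : inD X -> inD B -> 2 <= size X -> 2 <= size B ->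
  q * excess X B <= p * ((size X - 2) * (size B - 2)).
Proof.
(* The induction hypothesis serves to exchange the factors when [B] is larger than [X]. *)
have [n] := ubnP (size B); elim: n X B => // n IH X1 B ltB iX1 iB X1_2 B2.
rewrite leqNgt; apply/negP => bad.
(* This differs from the gap in the claim by [2 p (|B| - 2)], a constant in [X]; the shift makes it
   nonnegative, so the truncated subtraction is exact. *)
pose pot X := p * (size X * (size B - 2)) - q * excess X B.
have pot_nn X : q * excess X B <= p * (size X * (size B - 2)).
  by apply: leq_mul => //; exact: excess_trivial.
pose P X := inD X /\ 2 <= size X.
have [X2 PX2 min2] : exists2 X, P X & forall Y, P Y -> pot X <= pot Y.
  by apply: ex_minimal; exists X1.
have [X [[iX X_2] eX] minX] : exists2 X, P X /\ pot X <= pot X2 &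
    forall Y, P Y /\ pot Y <= pot X2 -> size X <= size Y.
  by apply: (ex_minimal (P := fun X => P X /\ pot X <= pot X2)); exists X2.
have minp Y : P Y -> pot X <= pot Y by move=> PY; apply: leq_trans eX (min2 _ PY).
have badX : p * ((size X - 2) * (size B - 2)) < q * excess X B.
  have : pot X <= pot X1 by exact: minp.
  rewrite /pot; have := pot_nn X1; have := pot_nn X; move: bad X1_2 X_2.
  case: (size X) => [|[|k]] //; case: (size X1) => [|[|k1]] // + _ _.
  by rewrite !subSS !subn0 !mulSn; lia.
have [uX _] := iX; have [uB _] := iB.
have X3 : 3 <= size X.
  rewrite ltnNge; apply/negP => leX; suff: excess X B = 0 by move=> e; rewrite e muln0 in badX.
  by rewrite /excess big1 // => g _; have := nrep_size_l X g uB; lia.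
have B3 : 3 <= size B.
  rewrite ltnNge; apply/negP => leB; suff: excess X B = 0 by move=> e; rewrite e muln0 in badX.
  by rewrite /excess big1 // => g _; have := nrep_size X B g; lia.
have leBX : size B <= size X.
  rewrite leqNgt; apply/negP => ltX.
  have := IH (map ginv B) (map ginv X); rewrite !size_map.
  have := excess_inv X uB => le1 H.
  have := H (leq_trans ltX ltB) (inD_inv iB) (inD_inv iX) B2 X_2.
  rewrite [(size B - 2) * _]mulnC; nia.
move: badX; rewrite ltnNge => /negP; apply; apply: excess_atom => //.
move=> g y z Dg yX zX yz gy gz.
pose gX := map (gmul g) X.
have igX : inD gX by exact: inD_translate.
have sgX : size gX = size X by rewrite size_map.
have cap2 : 2 <= size (capl X gX).
  have sub: {subset [:: gmul g y; gmul g z] <= capl X gX}.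
    by move=> x; rewrite !inE mem_filter => /orP[]/eqP ->; rewrite map_f.
  have := @uniq_leq_size _ [:: gmul g y; gmul g z] (capl X gX) => /=; apply => //.
  by rewrite inE andbT; apply/eqP => /gmul_inj.
have Pcap : P (capl X gX) by split; [exact: inD_cap | ].
have := size_cap_cup uX (proj1 igX).
have cuple : size X <= size (cupl X gX) by rewrite size_cat leq_addr.
have Pcup : P (cupl X gX) by split; [exact: inD_cup | lia].
move=> scc.
have eg : pot gX <= pot X.
  by rewrite /pot sgX; apply: leq_sub2l; apply: leq_mul => //; exact: excess_translate.
have potc : pot (capl X gX) + pot (cupl X gX) <= pot X + pot gX.
  have e1 : p * (size (capl X gX) * (size B - 2)) + p * (size (cupl X gX) * (size B - 2))
     = p * (size X * (size B - 2)) + p * (size gX * (size B - 2)).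
    by rewrite -!mulnDr -!mulnDl scc.
  have e2 : q * excess X B + q * excess gX B
      <= q * excess (capl X gX) B + q * excess (cupl X gX) B.
    by rewrite -!mulnDr leq_mul2l excess_cap_cup orbT.
  rewrite /pot; have := pot_nn X; have := pot_nn gX; have := pot_nn (capl X gX).
  have := pot_nn (cupl X gX); move: e1 e2.
  move: (p * _) (p * _) (p * _) (p * _) (q * _) (q * _) (q * _) (q * _).
  by move=> ? ? ? ? ? ? ? ?; lia.
(* By submodularity the intersection and the union are minimizers as well, so the choice of a
   smallest minimizer forces [X] to be contained in [gX]. *)
have szc : size X <= size (capl X gX).
  apply: minX; split => //; have := minp _ Pcup; have := minp _ Pcap; lia.
have cX : {subset capl X gX <= X} by move=> x; rewrite mem_filter => /andP[].
have [_ E] := uniq_min_size (filter_uniq _ uX) cX szc.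
have Xg : {subset X <= gX} by move=> x; rewrite -E mem_filter => /andP[].
have [_ E2] := uniq_min_size uX Xg (eq_leq sgX).
by move=> x xX; rewrite E2 map_f.
Qed.

End ExcessBound.

(** * Walks, bridges and trees *)

Lemma equiv_eq (X : Type) : equiv (@eq X).
Proof. by split=> // x y z -> ->. Qed.

Definition conn (T : STree) (Rv : V T -> V T -> Prop) (F : E T -> Prop) x y :=
  exists p, gwalk Rv F x p y.

(** Distance in a quotient graph; it is used only for connected [F], where the minimum exists. *)
Definition wdist (T : STree) (Rv : V T -> V T -> Prop) (F : E T -> Prop) x y : nat :=
  epsilon (inhabits 0) (fun n => (exists2 p, gwalk Rv F x p y & size p = n) /\
    forall p, gwalk Rv F x p y -> n <= size p).

Section Walks.
Variables (T : STree) (Rv : V T -> V T -> Prop).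
Hypothesis eqRv : equiv Rv.
Implicit Types (F : E T -> Prop) (x y z : V T) (p : seq (E T)) (e f : E T).

Let rR x : Rv x x. Proof. by case: eqRv. Qed.
Let sR x y : Rv x y -> Rv y x. Proof. by case: eqRv => _ + _; apply. Qed.
Let tR x y z : Rv x y -> Rv y z -> Rv x z. Proof. by case: eqRv => _ _; apply. Qed.

Lemma tgt_rev e : tgt (erev e) = src e.
Proof. by rewrite /tgt rev_invol. Qed.

Lemma gwalk_ext F x x' p y y' : Rv x' x -> Rv y y' -> gwalk Rv F x p y -> gwalk Rv F x' p y'.
Proof.
elim: p x x' => [|e p IH] x x' xx yy /=; first by move=> xy; apply: tR xx (tR xy yy).
move=> [Fe [xe w]]; split=> //; split; first exact: tR xe.
by apply: IH w.
Qed.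

Lemma gwalk_sub F F' x p y : (forall e, F e -> F' e) -> gwalk Rv F x p y -> gwalk Rv F' x p y.
Proof. by move=> s; elim: p x => [|e p IH] x //= [/s Fe [xe w]]; split=> //; split=> //; exact: IH. Qed.

Lemma gwalk_cat F x p y q z : gwalk Rv F x p y -> gwalk Rv F y q z -> gwalk Rv F x (p ++ q) z.
Proof.
elim: p x => [|e p IH] x /=; first by move=> xy; apply: gwalk_ext.
by move=> [Fe [xe w]] w'; split=> //; split=> //; exact: IH w'.
Qed.

Lemma gwalk_rev F x p y : (forall e, F e -> F (erev e)) ->
  gwalk Rv F x p y -> gwalk Rv F y (rev (map (@erev T) p)) x.
Proof.
move=> sF; elim: p x => [|e p IH] x /=; first exact: sR.
move=> [Fe [xe w]]; rewrite rev_cons -cats1; apply: gwalk_cat (IH _ w) _ => /=.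
by rewrite tgt_rev; split; [exact: sF | split; [exact: rR | exact: sR]].
Qed.

Lemma gwalk_cross F (Y : V T -> Prop) x p y : (forall z z', Y z -> Rv z z' -> Y z') ->
  gwalk Rv F x p y -> Y x -> ~ Y y ->
  exists p1 f p2, [/\ p = p1 ++ f :: p2, gwalk Rv F x p1 (src f), gwalk Rv F (tgt f) p2 y &
    [/\ F f, Y (src f) & ~ Y (tgt f)]].
Proof.
move=> cY; elim: p x => [|e p IH] x /=; first by move=> xy Yx []; exact: cY xy.
move=> [Fe [xe w]] Yx nYy; have [Yt|nYt] := EM (Y (tgt e)).
  have [p1 [f [p2 [-> w1 w2 H]]]] := IH _ w Yt nYy.
  by exists (e :: p1), f, p2; split.
exists [::], e, p; split=> //; split=> //; exact: cY xe.
Qed.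

Lemma conn_refl F x : conn Rv F x x. Proof. by exists [::]; exact: rR. Qed.

Lemma conn_rel F x y : Rv x y -> conn Rv F x y. Proof. by exists [::]. Qed.

Lemma conn_trans F y x z : conn Rv F x y -> conn Rv F y z -> conn Rv F x z.
Proof. by move=> [p wp] [q wq]; exists (p ++ q); exact: gwalk_cat wp wq. Qed.

Lemma conn_sym F x y : (forall e, F e -> F (erev e)) -> conn Rv F x y -> conn Rv F y x.
Proof. by move=> sF [p wp]; exists (rev (map (@erev T) p)); exact: gwalk_rev. Qed.

Lemma conn_edge F e : F e -> conn Rv F (src e) (tgt e).
Proof. by move=> Fe; exists [:: e]; split=> //; split; exact: rR. Qed.

Lemma conn_sub F F' x y : (forall e, F e -> F' e) -> conn Rv F x y -> conn Rv F' x y.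
Proof. by move=> s [p w]; exists p; exact: gwalk_sub w. Qed.

Lemma conn_closed F (Y : V T -> Prop) x y : (forall z z', Y z -> Rv z z' -> Y z') ->
  (forall e, F e -> Y (src e) -> Y (tgt e)) -> conn Rv F x y -> Y x -> Y y.
Proof.
move=> cY cF [p w] Yx; apply: contrapT => nYy.
by have [p1 [f [p2 [_ _ _ [Ff /(cF _ Ff) Yf]]]]] := gwalk_cross cY w Yx nYy.
Qed.

Section Distance.
Variable F : E T -> Prop.
Hypothesis symF : forall e, F e -> F (erev e).
Hypothesis connF : forall x y, conn Rv F x y.
Notation d := (wdist Rv F).

Lemma wdistP x y : (exists2 p, gwalk Rv F x p y & size p = d x y) /\
    forall p, gwalk Rv F x p y -> d x y <= size p.
Proof.
apply: (epsilon_spec (inhabits 0) (fun n => (exists2 p, gwalk Rv F x p y & size p = n) /\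
    forall p, gwalk Rv F x p y -> n <= size p)).
have [p w m] := @ex_minimal _ (fun p => gwalk Rv F x p y) size (connF x y).
by exists (size p); split=> //; exists p.
Qed.

Lemma wdist_walk x y : exists2 p, gwalk Rv F x p y & size p = d x y.
Proof. by case: (wdistP x y). Qed.

Lemma wdist_le x p y : gwalk Rv F x p y -> d x y <= size p.
Proof. by case: (wdistP x y) => _; apply. Qed.

Lemma wdist_rel x y : Rv x y -> d x y = 0.
Proof. by move=> xy; apply/eqP; rewrite -leqn0; apply: (@wdist_le x [::]). Qed.

Lemma wdist_eq0 x y : d x y = 0 -> Rv x y.
Proof. by case: (wdist_walk x y) => -[|e p] //= w <-. Qed.

Lemma wdist_tri y x z : d x z <= d x y + d y z.
Proof.
have [p wp <-] := wdist_walk x y; have [q wq <-] := wdist_walk y z.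
by rewrite -size_cat; apply/wdist_le/gwalk_cat/wq.
Qed.

Lemma wdist_sym x y : d x y = d y x.
Proof.
apply/eqP; rewrite eqn_leq; apply/andP; split.
  by have [p /(gwalk_rev symF)/wdist_le + <-] := wdist_walk y x; rewrite size_rev size_map.
by have [p /(gwalk_rev symF)/wdist_le + <-] := wdist_walk x y; rewrite size_rev size_map.
Qed.

Lemma wdist_edge e : F e -> d (src e) (tgt e) <= 1.
Proof. by move=> Fe; apply: (@wdist_le _ [:: e]); split=> //; split; exact: rR. Qed.

Lemma wdist_cross (Y : V T -> Prop) x y : (forall z z', Y z -> Rv z z' -> Y z') ->
  Y x -> ~ Y y -> exists f, [/\ F f, Y (src f), ~ Y (tgt f) &
    d x (src f) + 1 + d (tgt f) y <= d x y].
Proof.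
move=> cY Yx nYy; have [p w <-] := wdist_walk x y.
have [p1 [f [p2 [-> w1 w2 [Ff Ys Yt]]]]] := gwalk_cross cY w Yx nYy.
exists f; split=> //; rewrite size_cat /= -addnA add1n.
by rewrite leq_add // ?ltnS wdist_le.
Qed.

Lemma wdist_first x y : ~ Rv x y ->
  exists f, [/\ F f, Rv x (src f) & d x y = (d (tgt f) y).+1].
Proof.
move=> nxy; have [[|f p] //= [Ff [xf w]] s] := wdist_walk x y.
exists f; split=> //; apply/eqP; rewrite eqn_leq -{2}s ltnS (wdist_le w) andbT.
rewrite -add1n; apply: leq_trans (wdist_tri (tgt f) _ _) _; rewrite leq_add2r.
by apply: (@wdist_le _ [:: f]); split=> //; split=> //; exact: rR.
Qed.

End Distance.

Section Bridges.
Variable Re : E T -> E T -> Prop.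
Hypothesis eqRe : equiv Re.
Hypothesis Re_src : forall e f, Re e f -> Rv (src e) (src f).
Hypothesis Re_rev : forall e f, Re e f -> Re (erev e) (erev f).

Definition without F e f := [/\ F f, ~ Re e f & ~ Re (erev e) f].

Definition bridge F e := ~ conn Rv (without F e) (src e) (tgt e).

Let sE e f : Re e f -> Re f e. Proof. by case: eqRe => _ + _; apply. Qed.

Lemma without_sym F e : (forall f, F f -> F (erev f)) ->
  forall f, without F e f -> without F e (erev f).
Proof.
move=> sF f [Ff n1 n2]; split; first exact: sF.
  by move=> /Re_rev; rewrite rev_invol.
by move=> /Re_rev; rewrite !rev_invol.
Qed.

Lemma bridge_rev F e : (forall f, F f -> F (erev f)) -> bridge F e -> bridge F (erev e).
Proof.
move=> sF b c; apply: b; apply: conn_sym; first exact: without_sym.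
move: c; rewrite tgt_rev /tgt; apply: conn_sub => f [Ff n1 n2]; split=> //.
by move: n2; rewrite rev_invol.
Qed.

Lemma greduced_behead e p : greduced Re (e :: p) -> greduced Re p.
Proof. by case: p => [|f p] //= []. Qed.

Lemma greduced_prefix p q : greduced Re (p ++ q) -> greduced Re p.
Proof.
elim: p => [|e p IH] //; case: p IH => [|f p] IH //= [n g].
by split=> //; exact: IH.
Qed.

Lemma gwalk_reduce F x p y : gwalk Rv F x p y -> ~ greduced Re p ->
  exists2 p', gwalk Rv F x p' y & size p' < size p.
Proof.
elim: p x => [|e [|f p] IH] x //; first by move=> _ [].
  by move=> _ [].
move=> /= [Fe [xe [Ff [ef w]]]] ng; have [r|nr] := EM (Re f (erev e)).
  exists p; last by rewrite /= ltnW.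
  apply: gwalk_ext w => //; apply: tR xe _; apply: sR.
  by have := Re_src (Re_rev r); rewrite rev_invol.
have [||p' w' s'] := IH (tgt e); first by split.
  by move=> g; apply: ng; split.
by exists (e :: p') => //=; split=> //.
Qed.

(** A shortest walk back from [tgt e] to [src e] avoiding [e] is reduced; preceded by [e] it would
    be a reduced circuit. *)
Lemma acyclic_bridge F : (forall e, F e -> F (erev e)) ->
  (forall x p, gwalk Rv F x p x -> greduced Re p -> p = nil) ->
  forall e, F e -> bridge F e.
Proof.
move=> sF ac e Fe c; have {}c := conn_sym (without_sym sF) c.
have [p w m] := @ex_minimal _ (fun p => gwalk Rv (without F e) (tgt e) p (src e)) size c.
have g : greduced Re p.
  apply: contrapT => /(gwalk_reduce w) [p' /m]; lia.
have: e :: p = nil; last by [].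
apply: (ac (src e)).
  by split=> //; split; [exact: rR | apply: gwalk_sub w => f []].
case: p w {m} g => [|f p] // [[_ _ n] _] g; split=> // r; apply: n; exact: sE.
Qed.

(** A closed walk that starts with the bridge [e] must return through the reverse of [e]. The
    stretch in between is a shorter reduced closed walk, empty by induction, so [e] is followed at
    once by its reverse. *)
Lemma bridges_acyclic F : (forall e, F e -> F (erev e)) -> (forall e, F e -> bridge F e) ->
  forall x p, gwalk Rv F x p x -> greduced Re p -> p = nil.
Proof.
move=> sF br x p; have [n] := ubnP (size p).
elim: n x p => // n IH x [//|e p] /= lt [Fe [xe w]] g; exfalso.
pose Y z := conn Rv (without F e) (tgt e) z.
have cY z z' : Y z -> Rv z z' -> Y z' by move=> Yz zz; apply: conn_trans Yz (conn_rel _ zz).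
have nYs : ~ Y (src e) by move=> /(conn_sym (without_sym sF)); exact: br.
have nYx : ~ Y x by move=> Yx; apply: nYs; exact: cY xe.
have [p1 [f [p2 [ep w1 w2 [Ff Yf nYf]]]]] := gwalk_cross cY w (conn_refl _ _) nYx.
have ref : Re (erev e) f.
  apply: contrapT => n2; apply: nYf; apply: conn_trans (conn_edge _) => //.
  by split=> // /Re_src/sR/(cY _ _ Yf).
have p1n : p1 = [::].
  apply: (IH (tgt e)); last by move: g; rewrite ep => /greduced_behead/greduced_prefix.
    by move: lt; rewrite ep size_cat /=; lia.
  by apply: gwalk_ext w1 => //; apply/sR/(Re_src ref).
by move: g; rewrite ep p1n /= => -[nef _]; apply: nef; exact: sE.
Qed.

End Bridges.
End Walks.

(** * Half-trees, distances and subtrees *)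

Section Tree.
Variable T : STree.
Hypothesis treeT : is_tree T.
Implicit Types (x y z v w : V T) (e f : E T) (W : V T -> Prop).

Notation d := (wdist (@eq (V T)) (fun _ => True)).

(** The half-tree containing [src e] after the edge is cut; [~ side e x] thus says that [e] points
    towards [x]. *)
Definition side e x := conn (@eq _) (without (@eq _) (fun _ => True) e) (src e) x.

Let eV := equiv_eq (V T).
Let eE := equiv_eq (E T).
Let symT (e : E T) : True -> True := id.
Let connT : forall x y : V T, conn (@eq _) (fun _ => True) x y := proj1 treeT.

Lemma side_src e : side e (src e). Proof. exact: conn_refl. Qed.

Lemma side_tgt e : ~ side e (tgt e).
Proof.
have := @acyclic_bridge _ _ eV _ eE; apply=> //; try by move=> ? ? ->.
by move=> x p w g; apply: (proj2 treeT) w g.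
Qed.

Lemma side_edge e f : side e (src f) -> f <> e -> side e (tgt f).
Proof.
move=> s ne; have [efr|ner] := EM (erev e = f).
  by move: s; rewrite -efr => /side_tgt.
by apply: (conn_trans eV s); apply: (conn_edge eV); split=> // ?; apply: ne.
Qed.

Lemma without_rev e f : without (@eq _) (fun _ : E T => True) (erev e) f ->
  without (@eq _) (fun _ => True) e f.
Proof. by move=> [_ n1 n2]; split=> //; rewrite -{1}(rev_invol e). Qed.

Lemma sideN e x : side (erev e) x <-> ~ side e x.
Proof.
have sy : forall f, without (@eq _) (fun _ : E T => True) e f -> without (@eq _) (fun _ => True) e (erev f).
  by apply: without_sym => // ? ? ->.
split.
  move=> s1 s2; apply: (@side_tgt e); apply: (conn_trans eV s2).
  by apply: (conn_sym eV sy); apply: conn_sub s1 => f; exact: without_rev.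
have [//|n1] := EM (side (erev e) x).
suff : side e x \/ side (erev e) x by case.
apply: (conn_closed (Y := fun z => side e z \/ side (erev e) z) _ _ (connT (src e) x)).
- by move=> z z' + <-.
- move=> f _ [s|s].
    have [->|ne] := EM (f = e); first by right; exact: side_src.
    by left; exact: side_edge.
  have [->|ne] := EM (f = erev e); first by left; rewrite tgt_rev; exact: side_src.
  by right; exact: side_edge.
- by left; exact: side_src.
Qed.

Lemma side_edgeE e f : f <> e -> f <> erev e -> side e (src f) <-> side e (tgt f).
Proof.
move=> n1 n2; split=> s; first exact: side_edge.
rewrite -tgt_rev; apply: side_edge => // e1; apply: n2; by rewrite -e1 rev_invol.
Qed.

Lemma dist_refl x : d x x = 0. Proof. by apply: wdist_rel. Qed.
Lemma dist_sym x y : d x y = d y x. Proof. exact: (wdist_sym eV symT connT). Qed.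
Lemma dist_tri y x z : d x z <= d x y + d y z. Proof. exact: (wdist_tri eV connT). Qed.
Lemma dist_eq0 x y : d x y = 0 -> x = y. Proof. exact: (wdist_eq0 connT). Qed.
Lemma dist_edge e : d (src e) (tgt e) <= 1. Proof. exact: (wdist_edge eV connT). Qed.

Lemma dist_sep e x y : side e x -> ~ side e y -> d x y = d x (src e) + 1 + d (tgt e) y.
Proof.
move=> sx nsy; apply/eqP; rewrite eqn_leq; apply/andP; split.
  apply: leq_trans (dist_tri (tgt e) _ _) _; rewrite leq_add2r.
  by apply: leq_trans (dist_tri (src e) _ _) _; rewrite leq_add2l dist_edge.
have cl z z' : side e z -> z = z' -> side e z' by move=> + <-.
have [f [_ sf ntf le]] := wdist_cross connT cl sx nsy.
suff <- : f = e by [].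
by apply: contrapT => ne; apply: ntf; exact: side_edge.
Qed.

Lemma toward x y : x <> y -> exists2 e, src e = x & ~ side e y.
Proof.
move=> nxy; have [e [_ xe dxy]] := wdist_first eV connT nxy.
exists e => // s; move: (dist_sep s (@side_tgt e)).
by rewrite dist_refl (dist_sym y) (dist_sym y) -xe dxy; lia.
Qed.

Lemma toward_unique e f x : src e = src f -> ~ side e x -> ~ side f x -> e = f.
Proof.
move=> s ne nf; apply: contrapT => d_ef.
have se : side e (tgt f).
  by apply: side_edge; [rewrite -s; exact: side_src | move=> h; apply: d_ef].
have := dist_sep se ne; have := dist_sep (side_src e) ne.
have := dist_sep (side_src f) nf; rewrite -s !dist_refl.
have := dist_tri (src e) (tgt f) x; lia.
Qed.

Lemma dist_toward e x : ~ side e x -> d (src e) x = (d (tgt e) x).+1.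
Proof. by move=> /(dist_sep (side_src e)); rewrite dist_refl. Qed.

Definition subtree_edge W e := W (src e) /\ W (tgt e).

Lemma subtree_cross W e x y : subtree W -> W x -> W y -> side e x -> ~ side e y ->
  subtree_edge W e.
Proof.
move=> [_ cW] Wx Wy sx nsy; have [p w] := cW _ _ Wx Wy.
have cl z z' : side e z -> z = z' -> side e z' by move=> + <-.
have [p1 [f [p2 [_ _ _ [Wf sf ntf]]]]] := gwalk_cross cl w sx nsy.
suff <- : f = e by [].
by apply: contrapT => ne; apply: ntf; exact: side_edge.
Qed.

Lemma subtree_toward W e x : subtree W -> W (src e) -> W x -> ~ side e x -> W (tgt e).
Proof. by move=> sW We Wx /(subtree_cross sW We Wx (side_src e)) []. Qed.

Lemma subtree_outside W x : subtree W -> ~ W x -> exists2 e, src e = x & forall y, W y -> ~ side e y.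
Proof.
move=> sW nWx; have [[w Ww] _] := sW.
have [e ex nw] : exists2 e, src e = x & ~ side e w by apply: toward => e; rewrite e in nWx.
exists e => // y Wy sy; apply: nWx; rewrite -ex.
by case: (subtree_cross sW Wy Ww sy nw).
Qed.

(** It is enough that [W] is closed under single steps towards its own points: iterating them gives
    a path inside [W]. *)
Lemma subtree_connected W : (exists x, W x) ->
  (forall e x, W (src e) -> W x -> ~ side e x -> W (tgt e)) -> subtree W.
Proof.
move=> ex cl; split=> // x y Wx Wy; have [n] := ubnP (d x y).
elim: n x Wx => // n IH x Wx lt; have [->|nxy] := EM (x = y); first by exists nil.
have [e ex_ ne] := toward nxy; subst x.
have Wt := cl _ _ Wx Wy ne.
have [|p w] := IH (tgt e) Wt; first by rewrite -ltnS -dist_toward.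
by exists (e :: p).
Qed.

End Tree.

(** * Groups acting on trees *)

Section ActionBasics.
Variables (G : Group) (T : STree) (act : Action G T).
Implicit Types (g h : G) (v x y : V T) (e f : E T).

Lemma actVK g v : actV act (ginv g) (actV act g v) = v.
Proof. by rewrite -actVM gmulV actV1. Qed.
Lemma actVKV g v : actV act g (actV act (ginv g) v) = v.
Proof. by rewrite -actVM gmulgV actV1. Qed.
Lemma actEK g e : actE act (ginv g) (actE act g e) = e.
Proof. by rewrite -actEM gmulV actE1. Qed.
Lemma actEKV g e : actE act g (actE act (ginv g) e) = e.
Proof. by rewrite -actEM gmulgV actE1. Qed.
Lemma actV_inj g x y : actV act g x = actV act g y -> x = y.
Proof. by move=> e; rewrite -(actVK g x) e actVK. Qed.
Lemma actE_inj g e f : actE act g e = actE act g f -> e = f.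
Proof. by move=> h; rewrite -(actEK g e) h actEK. Qed.
Lemma act_tgt g e : tgt (actE act g e) = actV act g (tgt e).
Proof. by rewrite /tgt act_rev act_src. Qed.

Variables (H : G -> Prop) (sH : subgroup H).

Lemma vH_equiv : equiv (vH act H).
Proof.
case: sH => h1 [hM hV]; split.
- by move=> x; exists gone; rewrite actV1.
- by move=> x y [h [Hh <-]]; exists (ginv h); split; [exact: hV | exact: actVK].
- by move=> x y z [h [Hh <-]] [k [Hk <-]]; exists (gmul k h); rewrite actVM; split=> //; exact: hM.
Qed.

Lemma eH_equiv : equiv (eH act H).
Proof.
case: sH => h1 [hM hV]; split.
- by move=> x; exists gone; rewrite actE1.
- by move=> x y [h [Hh <-]]; exists (ginv h); split; [exact: hV | exact: actEK].
- by move=> x y z [h [Hh <-]] [k [Hk <-]]; exists (gmul k h); rewrite actEM; split=> //; exact: hM.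
Qed.

Lemma eH_src e f : eH act H e f -> vH act H (src e) (src f).
Proof. by move=> [h [Hh <-]]; exists h; rewrite act_src. Qed.

Lemma eH_tgt e f : eH act H e f -> vH act H (tgt e) (tgt f).
Proof. by move=> [h [Hh <-]]; exists h; rewrite act_tgt. Qed.

Lemma eH_rev e f : eH act H e f -> eH act H (erev e) (erev f).
Proof. by move=> [h [Hh <-]]; exists h; rewrite act_rev. Qed.

Lemma eH_act h e : H h -> eH act H e (actE act h e).
Proof. by move=> Hh; exists h. Qed.

End ActionBasics.

(** * Elliptic and hyperbolic elements, minimal subtrees *)

Section TreeAction.
Variables (G : Group) (T : STree) (act : Action G T).
Hypothesis treeT : is_tree T.
Variables (A : G -> Prop) (ty : V T -> Prop).
Hypothesis sA : subgroup A.
Hypothesis edgeA : forall g f, A g <-> actE act g f = f.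
Hypothesis ty_act : forall g v, ty v -> ty (actV act g v).
Hypothesis ty_edge : forall f, ty (src f) <-> ~ ty (tgt f).
Implicit Types (g h : G) (v w x y : V T) (e f : E T) (W : V T -> Prop).

Notation d := (wdist (@eq (V T)) (fun _ => True)).
Notation "g *v x" := (actV act g x) (at level 35, right associativity).
Notation "g *e x" := (actE act g x) (at level 35, right associativity).

Let eV := equiv_eq (V T).

Lemma gwalk_act g F F' x p y : (forall f, F f -> F' (g *e f)) ->
  gwalk (@eq (V T)) F x p y -> gwalk (@eq _) F' (g *v x) (map (actE act g) p) (g *v y).
Proof.
move=> FF; elim: p x => [|e p IH] x /=; first by move=> ->.
by move=> [Fe [-> w]]; rewrite act_src act_tgt; split; [exact: FF | split=> //; exact: IH].
Qed.

Lemma side_act g e x : side e x -> side (g *e e) (g *v x).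
Proof.
move=> [p w]; exists (map (actE act g) p); rewrite act_src.
apply: gwalk_act w => f [_ n1 n2]; split=> //; first by move/actE_inj.
by rewrite act_rev => /actE_inj.
Qed.

Lemma sideN_act g e x : ~ side e x -> ~ side (g *e e) (g *v x).
Proof. by move=> n /(side_act (ginv g)); rewrite actEK actVK. Qed.

Lemma dist_act g x y : d (g *v x) (g *v y) = d x y.
Proof.
have cT := proj1 treeT.
have le h x' y' : d (h *v x') (h *v y') <= d x' y'.
  have [p w <-] := wdist_walk cT x' y'; rewrite -(size_map (actE act h)).
  by apply: (wdist_le cT); apply: gwalk_act w.
by apply/eqP; rewrite eqn_leq le -{1}(actVK act g x) -{1}(actVK act g y) le.
Qed.

Lemma ty_actE g v : ty (g *v v) <-> ty v.
Proof. by split; [move/(ty_act (ginv g)); rewrite actVK | exact: ty_act]. Qed.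

(** [ty] is an invariant 2-colouring (the orbit of [u0] in the application), and an inversion would
    exchange the colours. *)
Lemma no_inversion g f : g *e f <> erev f.
Proof.
move=> h; have := ty_edge f; rewrite -(ty_actE g (src f)) -act_src h.
by rewrite -/(tgt f); tauto.
Qed.

Lemma kernel_act a v : A a -> a *v v = v.
Proof.
move=> Aa; apply: contrapT => nv.
have [e es _] : exists2 e, src e = v & ~ side e (a *v v) by apply: (toward treeT) => e; apply: nv.
by apply: nv; rewrite -es -act_src; move/edgeA: Aa => ->.
Qed.

(** Suppose [g h] fixes [z], and let [e] start at [v] towards [w]. If [z] lies beyond [e], then
    [h z = g^-1 z] lies beyond [g^-1 e <> e], so on the near side of [e], and is as far from [v] and
    [w] as [z] is. In all cases [d z w = d z v + d v w]. The same for [h^-1 g^-1] exchanges [v] and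
    [w], which forces [d v w = 0]. *)
Lemma elliptic_mul g h v w : g *v v = v -> h *v w = w -> ~ A g -> ~ A h -> v <> w ->
  hyperbolic act (gmul g h).
Proof.
move=> gv hw nAg nAh nvw.
have key g' h' v' w' z : g' *v v' = v' -> h' *v w' = w' -> ~ A g' -> v' <> w' ->
    g' *v h' *v z = z -> d z w' = d z v' + d v' w'.
  move=> gv' hw' nA nvw' fz; have [e es ne] := toward treeT nvw'.
  have sep y : side e y -> d y w' = d y v' + d v' w'.
    by move=> sy; rewrite (dist_sep treeT sy ne) -es (dist_toward treeT ne) -addnA add1n.
  have [s|ns] := EM (side e z); first exact: sep.
  have e1 : h' *v z = ginv g' *v z by rewrite -{2}fz actVK.
  have s : side e (h' *v z).
    rewrite e1; apply: contrapT => n2; apply: nA; apply/(edgeA _ (ginv g' *e e)).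
    rewrite actEKV; apply: (@toward_unique _ treeT _ _ (ginv g' *v z)) => //; last exact: sideN_act.
    by rewrite act_src es -{2}gv' actVK.
  have := sep _ s; rewrite -{1}hw' dist_act => ->; congr addn.
  by rewrite e1 -(dist_act g') actVKV gv'.
move=> z; rewrite actVM => fz.
have d1 := key _ _ _ _ _ gv hw nAg nvw fz.
have nAh' : ~ A (ginv h) by case: sA => _ [_ V] /V; rewrite ginv_inv.
have hz : ginv h *v ginv g *v z = z by rewrite -{1}fz !actVK.
have d2 := key (ginv h) (ginv g) w v z _ _ nAh' _ hz.
have {}d2 : d z v = d z w + d w v.
  by apply: d2; [rewrite -{1}hw actVK | rewrite -{1}gv actVK | move=> e; apply: nvw].
apply: nvw; apply: (dist_eq0 treeT); have := dist_sym treeT v w; lia.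
Qed.

(** Take [l] outside [A] fixing [v]. An [h] that moves [v] is outside [A] and fixes another vertex,
    so [l h] would be hyperbolic. *)
Lemma elliptic_fixes (L : G -> Prop) (v0 : V T) : subgroup L -> ~ has_hyperbolic act L ->
  fixes_vertex act L.
Proof.
move=> [L1 [LM LV]] nh.
have ell l : L l -> exists v, l *v v = v.
  move=> Ll; apply: contrapT => no; apply: nh; exists l; split=> // v h; by apply: no; exists v.
have [[l [Ll nAl]]|allA] := EM (exists l, L l /\ ~ A l); last first.
  exists v0 => l Ll; apply: kernel_act; apply: contrapT => nA; by apply: allA; exists l.
have [v lv] := ell _ Ll; exists v => h Lh.
have [w hw] := ell _ Lh; have [Ah|nAh] := EM (A h); first exact: kernel_act.
have [->//|nvw] := EM (v = w).
by case: nh; exists (gmul l h); split; [exact: LM | exact: elliptic_mul nvw].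
Qed.

Lemma invariantE (H : G -> Prop) W h v : subgroup H -> H_invariant act H W -> H h ->
  W (h *v v) <-> W v.
Proof.
move=> [_ [_ HV]] iW Hh; split; last exact: iW.
by move/(iW _ _ (HV _ Hh)); rewrite actVK.
Qed.

(* The witness is a vertex of minimal displacement. *)
Lemma axis_vertex g : hyperbolic act g -> (exists v : V T, True) ->
  exists v, forall W, subtree W -> (forall x, W x <-> W (g *v x)) -> W v.
Proof.
move=> hg [v0 _].
have [v _ minv] := @ex_minimal _ (fun _ => True) (fun v => d v (g *v v)) (ex_intro _ v0 I).
exists v => W sW iW; apply: contrapT => nWv.
have [e ev We] := subtree_outside treeT sW nWv; subst v.
have [[w0 Ww0] _] := sW.
have [w Ww minw] := @ex_minimal _ W (fun w => d (src e) w) (ex_intro _ _ Ww0).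
(* [h] preserves the distance from the vertex to [W]; were its image on the near side of [e], that
   distance would strictly grow. *)
have moved h : h *v src e <> src e -> (forall x, W x -> W (h *v x)) -> ~ side e (h *v src e).
  move=> hv i1 s; have Wh : W (h *v w) by exact: i1.
  have := dist_sep treeT s (We _ Wh); rewrite dist_act => e1.
  case: (posnP (d (h *v src e) (src e))) => [/(dist_eq0 treeT)//|gt].
  by have := minw _ Wh; rewrite (dist_toward treeT (We _ Wh)); lia.
have n1 : ~ side e (g *v src e) by apply: moved; [exact: hg | move=> x /iW].
have n2 : ~ side e (ginv g *v src e).
  apply: moved; last by move=> x Wx; apply/iW; rewrite actVKV.
  by move=> h; apply: (hg (src e)); rewrite -{1}h actVKV.
have n3 : ~ side (g *e e) (src e) by move=> /(side_act (ginv g)); rewrite actEK.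
have ege : g *e e <> e by move=> h; apply: (hg (src e)); rewrite -act_src h.
have n4 : ~ side (g *e e) (tgt e).
  move=> s; apply: n3; apply/(side_edgeE treeT) => //.
    by move=> h; apply: ege.
  by move=> h; apply: (@no_inversion g (erev e)); rewrite rev_invol -act_rev -h.
(* The path from [src e] to its image starts with [e] and ends with the reverse of [g e], so [tgt e]
   is displaced by two less. *)
have := minv (tgt e) Logic.I.
have := dist_toward treeT n1; have := dist_toward treeT n4.
rewrite act_src act_tgt (dist_sym treeT (g *v src e)) (dist_sym treeT (g *v tgt e)); lia.
Qed.

Definition min_core (H : G -> Prop) x :=
  forall W, subtree W -> H_invariant act H W -> W x.

(** The intersection of all invariant subtrees could only fail by being empty; [axis_vertex]
    supplies a point. *)
Lemma min_core_exists (H : G -> Prop) : (exists v : V T, True) -> subgroup H ->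
  has_hyperbolic act H -> min_inv_subtree act H (min_core H).
Proof.
move=> v0 sH [g [Hg hg]].
have [v vW] := axis_vertex hg v0.
split; last split.
- apply: (subtree_connected treeT).
    by exists v => W sW iW; apply: vW => // x; rewrite (invariantE _ sH iW Hg).
  move=> e x We Wx ne W sW iW; apply: (subtree_toward treeT sW _ _ ne); [exact: We | exact: Wx].
- by move=> h x Hh Wx W sW iW; apply/(invariantE _ sH iW Hh); exact: Wx.
- by move=> W' sW' iW' _ x; apply.
Qed.

Lemma min_core_sub (H L : G -> Prop) W x : (forall g, L g -> H g) ->
  subtree W -> H_invariant act H W -> min_core L x -> W x.
Proof. by move=> LH sW iW; apply => // g v /LH; exact: iW. Qed.

Lemma degenerateP (H : G -> Prop) v : (exists f, src f = v) ->
  degenerate act H v <-> (forall h, H h -> h *v v = v -> A h).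
Proof.
move=> [f fv]; split.
  by move=> [e [ev He]] h Hh hv; apply/(edgeA _ e)/He.
by move=> HA; exists f; split=> // h Hh; rewrite -edgeA; split; [exact: HA | exact: kernel_act].
Qed.

Lemma degenerate_act (H : G -> Prop) v h : subgroup H -> H h ->
  degenerate act H v -> degenerate act H (h *v v).
Proof.
move=> [_ [HM HV]] Hh [e [ev He]]; exists (h *e e); split; first by rewrite act_src ev.
move=> k Hk; have := He (gmul (ginv h) (gmul k h)) (HM _ _ (HV _ Hh) (HM _ _ Hk Hh)).
rewrite !actVM !actEM => -[H1 H2]; split.
  by move=> e1; apply: (@actE_inj _ _ act (ginv h)); rewrite actEK H1 // e1 actVK.
by move=> e1; apply: (@actV_inj _ _ act (ginv h)); rewrite actVK H2 // e1 actEK.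
Qed.

(** Outside [W], the stabilizer of [v] in [H] must fix the unique edge at [v] that points to [W]. *)
Lemma nondegenerate_in_subtree (H : G -> Prop) W v : subgroup H -> subtree W ->
  H_invariant act H W -> ~ degenerate act H v -> W v.
Proof.
move=> sH sW iW nd; apply: contrapT => nW; apply: nd.
have [e ev We] := subtree_outside treeT sW nW; have [[w Ww] _] := sW.
exists e; split=> // h Hh; split=> [hv|he]; last by rewrite -ev -act_src he.
apply: (@toward_unique _ treeT _ _ w); [by rewrite act_src ev | | exact: We].
have Ww' : W (ginv h *v w) by apply: iW => //; case: sH => _ [_]; apply.
by have := @sideN_act h e _ (We _ Ww'); rewrite actVKV.
Qed.

End TreeAction.

(** * The rank of the quotient graph *)

Section Rank.
Variables (G : Group) (T : STree) (act : Action G T).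
Hypothesis treeT : is_tree T.
Variable ty : V T -> Prop.
Hypothesis ty_act : forall g v, ty v -> ty (actV act g v).
Hypothesis ty_edge : forall f, ty (src f) <-> ~ ty (tgt f).
Variables (H : G -> Prop) (W : V T -> Prop).
Hypothesis sH : subgroup H.
Hypothesis sW : subtree W.
Hypothesis iW : H_invariant act H W.
Implicit Types (g h : G) (v w x y z : V T) (e f : E T) (F S U : E T -> Prop).

Notation d := (wdist (@eq (V T)) (fun _ => True)).
Notation "g *v x" := (actV act g x) (at level 35, right associativity).
Notation "g *e x" := (actE act g x) (at level 35, right associativity).
Notation all_edges := (fun _ : E T => True).
Notation RV := (vH act H).
Notation RE := (eH act H).

Let eqV : equiv RV := vH_equiv act sH.
Let eqE : equiv RE := eH_equiv act sH.
Let RVr x : RV x x. Proof. by case: eqV. Qed.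
Let RVs x y : RV x y -> RV y x. Proof. by case: eqV => _ + _; apply. Qed.
Let RVt x y z : RV x y -> RV y z -> RV x z. Proof. by case: eqV => _ _; apply. Qed.
Let REr (x : E T) : RE x x. Proof. by case: eqE. Qed.
Let REs (x y : E T) : RE x y -> RE y x. Proof. by case: eqE => _ + _; apply. Qed.
Let REt (x y z : E T) : RE x y -> RE y z -> RE x z. Proof. by case: eqE => _ _; apply. Qed.

Definition invar S := forall e f, S e -> RE e f -> S f.

(** [U] selects one orientation of each geometric edge; reversal embeds either half into the
    other. *)
Lemma enum_reps_double S U l : invar S -> invar U -> (forall e, S e -> S (erev e)) ->
  (forall e, S e -> U e <-> ~ U (erev e)) -> enumerates (reps RE S) l ->
  size l = 2 * count (fun e => `[< U e >]) l.
Proof.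
move=> iS iU symS flip [ul lS].
rewrite -(count_predC (fun e => `[< U e >])) mul2n -addnn; congr addn.
have half (U' : E T -> Prop) (a b : pred (E T)) : (forall e, a e <-> U' e) -> (forall e, b e <-> ~ U' e) ->
    invar U' -> (forall e, S e -> U' e <-> ~ U' (erev e)) -> count a l <= count b l.
  move=> aU bU iU' fl; rewrite -(size_filter b).
  apply: (leq_count_inj (f := fun e => rep RE (erev e))) => //.
    move=> e f /lS[_ re] /lS[_ rf] _ _ /(rep_inj eqE) ef.
    by have := rep_eq eqE (eH_rev ef); rewrite !rev_invol re rf.
  move=> e /lS[Se _] /aU/(fl _ Se) nU; rewrite mem_filter; apply/andP; split.
    apply/bU => /iU' /(_ (REs (rep_rel eqE _))) /nU; apply.
  by apply/lS; apply: reps_rep => //; exact: symS.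
have iUc : invar (fun e => ~ U e) by move=> e f nU ef /iU /(_ (REs ef)).
have bP P : `[< P >] <-> P by split=> /asboolP.
have bnP P : `[< P >] <-> ~ ~ P by rewrite not_notE.
have nP P : ~~ `[< P >] <-> ~ P by split=> /asboolPn.
apply/eqP; rewrite eqn_leq; apply/andP; split.
  apply: (half (fun e => ~ U e)) => //; first by move=> e; exact (nP (U e)).
  by move=> e Se; have := flip _ Se; have := lem (U e); have := lem (U (erev e)); tauto.
by apply: (half U) => // e; exact (nP (U e)).
Qed.

Definition WE := subtree_edge W.

Lemma WE_invar : invar WE.
Proof.
by move=> e f [Ws Wt] [h [Hh <-]]; split; rewrite ?act_src ?act_tgt; exact: iW.
Qed.

Lemma WE_rev e : WE e -> WE (erev e).
Proof. by move=> [Ws Wt]; split; rewrite ?tgt_rev. Qed.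

Lemma ty_invar : invar (fun e => ty (src e)).
Proof. by move=> e f te [h [_ <-]]; rewrite act_src; exact: ty_act. Qed.

(** The image of a half-tree in [T/H], written as an [H]-invariant set. For [e] pointing into [W] it
    separates the two ends of [e] in the quotient. *)
Definition Hside e z := exists2 h, H h & side (h *e e) z.

Lemma Hside_closed e z z' : Hside e z -> RV z z' -> Hside e z'.
Proof.
case: sH => _ [HM _]; move=> [h Hh s] [k [Hk <-]]; exists (gmul k h); first exact: HM.
by rewrite actEM; apply: side_act.
Qed.

Lemma Hside_src e : Hside e (src e).
Proof. by exists gone; [case: sH | rewrite actE1; exact: side_src]. Qed.

Lemma Hside_cross e f : Hside e (src f) -> ~ Hside e (tgt f) -> RE e f.
Proof.
move=> [h Hh s] n; exists h; split=> //; apply: contrapT => ne; apply: n; exists h => //.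
by apply: side_edge => // h1; apply: ne.
Qed.

Section Outer.
Variable e : E T.
Hypothesis out : forall w, W w -> ~ side e w.

Lemma Hside_out w : W w -> ~ Hside e w.
Proof.
move=> Ww [h Hh /(side_act act (ginv h))]; rewrite actEK; apply: out.
by apply: iW => //; case: sH => _ [_]; apply.
Qed.

(** Otherwise [src e] lies in the outer half of some [h e <> e], so its path to [W] runs through
    [h (src e)]. Both vertices are equally far from [W], so they coincide, and then so do the two
    edges pointing to [W]. *)
Lemma Hside_tgt : ~ Hside e (tgt e).
Proof.
move=> [h Hh s].
have nee : h *e e <> e by move=> he; move: s; rewrite he; exact: side_tgt.
have {}s : side (h *e e) (src e).
  apply/(side_edgeE treeT) => // h1; first by apply: nee.
  by apply: (@no_inversion _ _ act ty ty_act ty_edge h e); rewrite -[LHS]rev_invol -h1.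
have [[w0 Ww0] _] := sW.
have [w Ww minw] := @ex_minimal _ W (fun w => d (src e) w) (ex_intro _ _ Ww0).
have nh w' : W w' -> ~ side (h *e e) w' by move=> /Hside_out n s'; apply: n; exists h.
have Wh : W (ginv h *v w) by apply: iW => //; case: sH => _ [_]; apply.
have := minw _ Wh; rewrite -(dist_act act treeT h (src e) (ginv h *v w)) actVKV.
have := dist_sep treeT s (nh _ Ww); have := dist_toward treeT (nh _ Ww).
rewrite act_src => e1 e2 le.
have /(dist_eq0 treeT) e3 : d (src e) (h *v src e) = 0 by lia.
apply: nee; apply: (@toward_unique _ treeT _ _ w); [by rewrite act_src -e3 | exact: nh | exact: out].
Qed.

Lemma outer_bridge : bridge RV RE all_edges e.
Proof.
move=> c; apply: Hside_tgt.
apply: (conn_closed (Y := Hside e) _ _ c); [exact: Hside_closed | | exact: Hside_src].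
by move=> f [_ n1 _] s; apply: contrapT => n; apply: n1; exact: Hside_cross.
Qed.

End Outer.

Lemma notWE_out e : ~ WE e -> (forall w, W w -> ~ side e w) \/ (forall w, W w -> ~ side (erev e) w).
Proof.
move=> nW; have [|n1] := EM (forall w, W w -> ~ side e w); first by left.
right=> w Ww /(sideN treeT) nse; apply: n1 => w' Ww' se; apply: nW.
exact: subtree_cross sW Ww' Ww se nse.
Qed.

Let RE_src e f : RE e f -> RV (src e) (src f) := @eH_src _ _ act H e f.
Let RE_rev e f : RE e f -> RE (erev e) (erev f) := @eH_rev _ _ act H e f.

Lemma bridge_sub F F' e : (forall f, F f -> F' f) -> bridge RV RE F' e -> bridge RV RE F e.
Proof. by move=> s b c; apply: b; apply: conn_sub c => f [/s]. Qed.

(** Off [W] the quotient consists of branches hanging on [W/H], which contribute nothing to the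
    rank. *)
Lemma notWE_bridge e : ~ WE e -> bridge RV RE all_edges e.
Proof.
case/notWE_out => [|/outer_bridge]; first exact: outer_bridge.
by rewrite -{2}(rev_invol e); apply: (bridge_rev eqV) => //; exact: RE_rev.
Qed.

Lemma connH x y : conn RV all_edges x y.
Proof.
have [p w] := proj1 treeT x y; exists p; elim: p x w => [|e p IH] x /=; first by move=> ->.
by move=> [_ [-> w]]; split=> //; split=> //; exact: IH.
Qed.

Variables (lV : seq (V T)) (lE : seq (E T)).
Hypothesis lVP : enumerates (reps RV W) lV.
Hypothesis lEP : enumerates (reps RE WE) lE.

Definition spanning F := [/\ invar F, forall e, F e -> F (erev e),
  forall x y, conn RV F x y & forall e, ~ WE e -> F e].

Lemma without_invar F e : invar F -> invar (without RE F e).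
Proof.
move=> iF f f' [Ff n1 n2] ff; split; first exact: iF ff.
  by move=> r; apply: n1; apply: REt r (REs ff).
by move=> r; apply: n2; apply: REt r (REs ff).
Qed.

Lemma without_conn F e : (forall f, F f -> F (erev f)) -> ~ bridge RV RE F e ->
  (forall x y, conn RV F x y) -> forall x y, conn RV (without RE F e) x y.
Proof.
move=> sF /contrapT c cF x y.
have c' : conn RV (without RE F e) (tgt e) (src e) by apply: conn_sym c => //; apply: without_sym.
apply: (conn_closed (Y := conn RV (without RE F e) x) _ _ (cF x y)).
- by move=> z z' xz zz; apply: (conn_trans eqV xz); apply: conn_rel.
- move=> f Ff xf; have [ef|n1] := EM (RE e f).
    apply: (conn_trans eqV xf); apply: (conn_trans eqV _ (conn_rel _ (eH_tgt ef))).
    by apply: (conn_trans eqV _ c); apply: conn_rel; apply/RVs/RE_src.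
  have [ef|n2] := EM (RE (erev e) f).
    apply: (conn_trans eqV xf); apply: (conn_trans eqV _ (conn_rel _ (eH_tgt ef))).
    rewrite tgt_rev; apply: (conn_trans eqV _ c'); apply: conn_rel; apply/RVs; exact: (RE_src ef).
  by apply: (conn_trans eqV xf); apply: (conn_edge eqV).
- exact: conn_refl.
Qed.

(** Spanning sets contain all edges off [W], so the finite count over [lE] measures them; at a
    minimum no edge can be deleted. *)
Lemma spanning_tree_exists : exists2 F, spanning F & forall e, F e -> bridge RV RE F e.
Proof.
have sp0 : spanning all_edges by split=> //; exact: connH.
have [F spF minF] := @ex_minimal _ spanning (fun F => count (fun e => `[< F e >]) lE)
  (ex_intro _ _ sp0).
exists F => // e Fe; case: (spF) => iF sF cF oF.
have [We|/notWE_bridge] := EM (WE e); last by apply: bridge_sub.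
apply: contrapT => nb.
have /minF : spanning (without RE F e).
  split; [exact: without_invar | exact: without_sym | exact: without_conn |].
  move=> f nWf; split; first exact: oF.
    by move=> ef; apply: nWf; exact: WE_invar ef.
  by move=> ef; apply: nWf; apply: WE_invar ef; exact: WE_rev.
rewrite leqNgt => /negP; apply.
have rl : rep RE e \in lE by apply/(proj2 lEP); apply: reps_rep => //; exact: WE_invar.
have Fr : F (rep RE e) by apply: iF Fe (rep_rel eqE e).
apply: (ltn_count (x := rep RE e)) => //; first by move=> f /asboolP[Ff _ _]; apply/asboolP.
  exact/asboolP.
by apply/asboolPn => -[_ n _]; apply: n; exact: rep_rel.
Qed.

Lemma enum_complement F : (forall e, ~ WE e -> F e) ->
  enumerates (reps RE (fun e => ~ F e)) [seq e <- lE | `[< ~ F e >]].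
Proof.
move=> oF; split; first exact/filter_uniq/(proj1 lEP).
move=> e; rewrite mem_filter; split; first by case/andP => /asboolP nF /(proj2 lEP) [].
move=> [nF re]; apply/andP; split; first exact/asboolP.
by apply/(proj2 lEP); split=> //; apply: contrapT => /oF.
Qed.

Lemma invarN F : invar F -> invar (fun e => ~ F e).
Proof. by move=> iF e f nF ef Ff; apply: nF; apply: iF Ff (REs ef). Qed.

Lemma rank_exists : exists r, rank_is act H r.
Proof.
have [F [iF sF cF oF] br] := spanning_tree_exists.
have N2 := enum_reps_double (invarN iF) ty_invar.
exists (count (fun e => `[< ty (src e) >]) [seq e <- lE | `[< ~ F e >]]), F; split.
  by move=> h e Hh Fe; apply: iF Fe _; exists h.
split=> //; split=> //; split; first by apply: (bridges_acyclic eqV eqE) => //; exact: RE_rev.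
apply/(nclsP eqE _ (invarN iF)); exists [seq e <- lE | `[< ~ F e >]].
  exact: enum_complement.
apply: N2 => //; last exact: enum_complement.
by move=> e nF /sF; rewrite rev_invol.
Qed.

Section Counting.
Variables (F : E T -> Prop) (x0 : V T).
Hypotheses (iF : invar F) (sF : forall e, F e -> F (erev e)).
Hypothesis cF : forall x y, conn RV F x y.
Hypothesis brF : forall e, F e -> bridge RV RE F e.
Hypothesis Wx0 : W x0.

Lemma notWE_in e : ~ WE e -> F e.
Proof.
move=> nW; apply: contrapT => nF; apply: (notWE_bridge nW).
apply: conn_sub (cF _ _) => f Ff; split=> // ef; apply: nF; first exact: iF Ff (REs ef).
by rewrite -(rev_invol e); apply/sF/(iF Ff)/REs.
Qed.

Notation dF v := (wdist RV F v x0).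

Definition parent_spec v (o : option (E T)) :=
  if o is Some e then [/\ F e, src e = v, ~ RV v x0 & dF v = (dF (tgt e)).+1] else RV v x0.

Lemma parent_exists v : exists o, parent_spec v o.
Proof.
have [h|n] := EM (RV v x0); first by exists None.
have [e [Fe [h [Hh hv]] de]] := wdist_first eqV cF n.
have er : RE e (ginv h *e e).
  by apply: REs; exists h; rewrite actEKV.
exists (Some (ginv h *e e)); split=> //; first exact: iF er.
  by rewrite act_src -hv actVK.
rewrite de; congr S; apply/eqP; rewrite eqn_leq; apply/andP; split.
  have [p w <-] := wdist_walk cF (tgt (ginv h *e e)) x0.
  by apply: (wdist_le cF); apply: (gwalk_ext eqV _ _ w) => //; exact: eH_tgt.
have [p w <-] := wdist_walk cF (tgt e) x0.
by apply: (wdist_le cF); apply: (gwalk_ext eqV _ _ w) => //; exact/RVs/eH_tgt.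
Qed.

Lemma dF_rel v w : RV v w -> dF v = dF w.
Proof.
move=> vw; apply/eqP; rewrite eqn_leq; apply/andP; split.
  have [p wk <-] := wdist_walk cF w x0.
  by apply: (wdist_le cF); apply: (gwalk_ext eqV _ _ wk).
have [p wk <-] := wdist_walk cF v x0.
by apply: (wdist_le cF); apply: (gwalk_ext eqV _ _ wk) => //; exact: RVs.
Qed.

Definition parent := projT1 (choice parent_exists).

Lemma parentP v : parent_spec v (parent v).
Proof. exact: (projT2 (choice parent_exists)). Qed.

Definition up e := exists2 e', parent (rep RV (src e)) = Some e' & RE e' e.

Lemma upP e : up e -> [/\ F e, ~ RV (src e) x0 & dF (src e) = (dF (tgt e)).+1].
Proof.
move=> [e' pe ee]; have := parentP (rep RV (src e)); rewrite pe => -[Fe' es n de].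
have r := rep_rel eqV (src e); split; first exact: iF ee.
  by move=> h; apply: n; apply: RVt h; exact: RVs.
by rewrite (dF_rel r) de (dF_rel (eH_tgt ee)).
Qed.

Lemma up_invar : invar up.
Proof.
move=> e f [e' pe ee] ef; exists e'; last exact: REt ef.
by rewrite -(rep_eq eqV (RE_src ef)).
Qed.

(** Distances to the root exclude both orientations being up. If neither were, the parent walks from
    both ends would avoid [e], which is a bridge. *)
Lemma up_flip e : F e -> up e <-> ~ up (erev e).
Proof.
move=> Fe; split.
  by move=> /upP [_ _ d1] /upP [_ _]; rewrite tgt_rev; move: d1; rewrite /tgt; lia.
move=> nur; apply: contrapT => nu; apply: (brF Fe).
have key n v : dF v = n -> conn RV (without RE F e) v x0.
  elim: n v => [|n IH] v dv; first by apply: conn_rel; apply: (wdist_eq0 cF).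
  have := parentP (rep RV v); case pv: (parent _) => [f|]; last first.
    by move=> h; apply: conn_rel; apply: RVt h; exact: rep_rel.
  have rv := rep_rel eqV v.
  move=> [Ff fs nx df].
  have cf : conn RV (without RE F e) (src f) (tgt f).
    apply: (conn_edge eqV); split=> // ef.
      apply: nu; exists f; last exact: REs.
      by rewrite -pv (rep_eq eqV (RE_src ef)) fs (rep_rep eqV).
    apply: nur; exists f; last exact: REs.
    by rewrite -pv (rep_eq eqV (RE_src ef)) fs (rep_rep eqV).
  apply: (conn_trans eqV (conn_rel _ rv)); rewrite -{1}fs; apply: (conn_trans eqV cf).
  by apply: IH; move: df; rewrite -(dF_rel rv) dv => -[].
apply: (conn_trans eqV (key _ _ erefl)).
by apply: conn_sym (key _ _ erefl) => //; exact: without_sym.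
Qed.

(** A parent edge that left [W] would enter a branch attached along that edge only; a shortest walk
    would not cross it and come back. *)
Lemma up_WE e : W (src e) -> up e -> WE e.
Proof.
move=> Ws /upP[Fe n de]; split=> //; apply: contrapT => nWt.
have out w : W w -> ~ side (erev e) w.
  move=> Ww /(sideN treeT) nse; apply: nWt.
  by case: (subtree_cross treeT sW Ws Ww (side_src e) nse).
have [f [Ff sf nf le]] := wdist_cross cF (@Hside_closed (erev e)) (Hside_src (erev e)) (Hside_out out Wx0).
have := eH_tgt (Hside_cross sf nf); rewrite tgt_rev => /dF_rel df.
by move: le; rewrite -df de /tgt; lia.
Qed.

(** Vertex classes other than the root correspond to their parent edges; the successor accounts for
    the root. *)
Lemma count_up : (count (fun e => `[< up e >]) [seq e <- lE | `[< F e >]]).+1 = size lV.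
Proof.
have [uV lVS] := lVP; have [uE lES] := lEP.
have <- : count (fun v => `[< RV v x0 >]) lV + count (fun v => `[< ~ RV v x0 >]) lV = size lV.
  rewrite -(count_predC (fun v => `[< RV v x0 >])); congr addn.
  by apply: eq_count => v /=; rewrite asbool_neg.
have -> : count (fun v => `[< RV v x0 >]) lV = 1.
  have rl : rep RV x0 \in lV by apply/lVS; apply: reps_rep => // y z Wy [h [Hh <-]]; exact: iW.
  have <- : count_mem (rep RV x0) lV = 1 by rewrite count_uniq_mem // rl.
  apply: eq_in_count => v /lVS [_ rv]; apply/asboolP/eqP => [h|->].
    by rewrite -rv; exact: rep_eq.
  by apply: RVs; exact: rep_rel.
rewrite add1n; congr S; apply/eqP; rewrite eqn_leq; apply/andP; split.
  rewrite -(size_filter _ lV); apply: (leq_count_inj (f := fun e => rep RV (src e))).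
  - exact: filter_uniq.
  - move=> e f; rewrite !mem_filter => /andP[_ /lES[_ re]] /andP[_ /lES[_ rf]].
    move=> /asboolP[e' pe ee] /asboolP[f' pf ff] ss.
    rewrite -re -rf; apply: rep_eq => //; apply: REt ff; apply: REs.
    by move: pe; rewrite ss pf => -[->].
  - move=> e; rewrite mem_filter => /andP[_ /lES[[Ws Wt] re]] /asboolP /upP[_ n _].
    rewrite mem_filter; apply/andP; split.
      by apply/asboolP => h; apply: n; apply: RVt h; exact: rep_rel.
    by apply/lVS; apply: reps_rep => // y z Wy [h [Hh <-]]; exact: iW.
pose pr v := if parent v is Some e then Some (rep RE e) else None.
rewrite -(size_filter _ (filter _ _)) -(size_map Some).
apply: (leq_count_inj (f := pr)) => //.
  move=> v w /lVS[_ rv] /lVS[_ rw] /asboolP nv /asboolP nw; rewrite /pr.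
  have := parentP v; have := parentP w; case: (parent v) => [e|//]; case: (parent w) => [f|//].
  move=> [_ fs _ _] [_ es _ _] [/(rep_inj eqE) ef].
  by rewrite -rv -rw -fs -es; apply: rep_eq => //; exact: RE_src.
move=> v /lVS[Wv rv] /asboolP nv; rewrite /pr.
have := parentP v; case pv: (parent v) => [e|//] [Fe es _ de].
have ue : up e by exists e => //; rewrite es rv.
have We : WE e by apply: up_WE => //; rewrite es.
have re := rep_rel eqE e.
apply: map_f; rewrite !mem_filter; apply/and3P; split.
- by apply/asboolP; exact: up_invar re.
- by apply/asboolP; exact: iF re.
- by apply/lES; apply: reps_rep => //; exact: WE_invar.
Qed.

(** Euler characteristic of [W/H] in oriented edges: [2 (|V| - 1)] in the tree and [2 r] outside
    it. *)
Lemma edge_count r : ncls RE (fun e => ~ F e) (2 * r) -> size lE + 2 = 2 * r + 2 * size lV.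
Proof.
move=> nr.
have co := enum_complement notWE_in.
have sz : size [seq e <- lE | `[< ~ F e >]] = 2 * r.
  apply: (ncls_unique eqE (invarN iF)) nr; apply/(nclsP eqE _ (invarN iF)).
  by exists [seq e <- lE | `[< ~ F e >]].
have FP : enumerates (reps RE (fun e => WE e /\ F e)) [seq e <- lE | `[< F e >]].
  split; first exact/filter_uniq/(proj1 lEP).
  move=> e; rewrite mem_filter; split; first by case/andP => /asboolP Fe /(proj2 lEP) [].
  by move=> [[We Fe] re]; apply/andP; split; [exact/asboolP | apply/(proj2 lEP)].
have iWF : invar (fun e => WE e /\ F e).
  by move=> e f [We Fe] ef; split; [exact: WE_invar ef | exact: iF ef].
have := enum_reps_double iWF up_invar _ _ FP.
have := count_up; rewrite -sz.
have <- : size [seq e <- lE | `[< F e >]] + size [seq e <- lE | `[< ~ F e >]] = size lE.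
  rewrite !size_filter -(count_predC (fun e => `[< F e >])); congr addn.
  by apply: eq_count => e /=; rewrite asbool_neg.
move=> <- ->; first by lia.
  by move=> e [We Fe]; split; [exact: WE_rev | exact: sF].
by move=> e [_ Fe]; exact: up_flip.
Qed.

End Counting.

Lemma rank_count r : rank_is act H r -> size lE + 2 = 2 * r + 2 * size lV.
Proof.
move=> [F [iF [sF [cF [ac nr]]]]].
have iF' : invar F by move=> e f Fe [h [Hh <-]]; exact: iF.
have [[x0 Wx0] _] := sW.
apply: (edge_count iF' sF cF _ Wx0 nr).
by apply: (acyclic_bridge eqV eqE).
Qed.

Lemma rankTH_count : size lE + 2 = 2 * rankTH act H + 2 * size lV.
Proof. by apply: rank_count; apply: epsilon_spec; exact: rank_exists. Qed.

End Rank.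

(** * Quotient groups *)

Section Quotient.
Variables (G : Group) (A : G -> Prop).
Hypotheses (sA : subgroup A) (nA : normal A).
Implicit Types x y z : G.

Lemma normal_conj g a : A a -> A (gmul g (gmul a (ginv g))).
Proof. by move=> /(nA (ginv g)); rewrite ginv_inv. Qed.

Definition coset_rel x y := A (gmul (ginv x) y).

Lemma coset_equiv : equiv coset_rel.
Proof.
case: sA => A1 [AM AV]; split; rewrite /coset_rel.
- by move=> x; rewrite gmulV.
- by move=> x y /AV; rewrite ginv_mul ginv_inv.
- by move=> x y z xy yz; have := AM _ _ xy yz; rewrite -gmulA gmulKg.
Qed.

Notation crep := (rep coset_rel).

(** Cosets are encoded by canonical representatives, so that [sval] is a section of the
    projection. *)
Definition quo := {x : G | crep x = x}.

Definition qpi x : quo := exist _ (crep x) (rep_rep coset_equiv x).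

Lemma quo_eq (a b : quo) : sval a = sval b -> a = b.
Proof. by case: a b => [x hx] [y hy] /= e; subst y; rewrite (Prop_irrelevance hx hy). Qed.

Lemma qpi_val (a : quo) : qpi (sval a) = a.
Proof. by apply: quo_eq; case: a. Qed.

Lemma qpi_eq x y : qpi x = qpi y <-> A (gmul (ginv x) y).
Proof.
split=> [[]|xy]; first exact: (rep_inj coset_equiv).
by apply: quo_eq; apply: (rep_eq coset_equiv).
Qed.

Lemma coset_mul x x' y y' : coset_rel x x' -> coset_rel y y' -> coset_rel (gmul x y) (gmul x' y').
Proof.
case: sA => A1 [AM AV]; rewrite /coset_rel => xx yy.
have := AM _ _ (nA y xx) yy.
by rewrite ginv_mul -!gmulA gmulKg.
Qed.

Definition qmul (a b : quo) := qpi (gmul (sval a) (sval b)).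
Definition qinv (a : quo) := qpi (ginv (sval a)).

Lemma qpi_mul x y : qpi (gmul x y) = qmul (qpi x) (qpi y).
Proof.
by apply: quo_eq; apply: (rep_eq coset_equiv); apply: coset_mul; exact: rep_rel coset_equiv _.
Qed.

Lemma qmulA a b c : qmul a (qmul b c) = qmul (qmul a b) c.
Proof. by rewrite -(qpi_val a) -(qpi_val b) -(qpi_val c) -!qpi_mul gmulA. Qed.

Lemma qmul1 a : qmul (qpi gone) a = a.
Proof. by rewrite -{1}(qpi_val a) -qpi_mul gmul1 qpi_val. Qed.

Lemma qmulV a : qmul (qinv a) a = qpi gone.
Proof. by rewrite -{2}(qpi_val a) -qpi_mul gmulV. Qed.

Definition quo_group : Group := mkGroup qmulA qmul1 qmulV.

Definition qproj x : quo_group := qpi x.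

Lemma qprojM x y : qproj (gmul x y) = gmul (qproj x) (qproj y).
Proof. exact: qpi_mul. Qed.

Lemma qproj1 : qproj gone = gone.
Proof. by []. Qed.

Lemma qprojV x : qproj (ginv x) = ginv (qproj x).
Proof. by apply: (@gmul_injr _ (qproj x)); rewrite gmulV -qprojM gmulV. Qed.

Lemma qproj_eq x y : qproj x = qproj y <-> A (gmul (ginv x) y).
Proof. exact: qpi_eq. Qed.

Lemma qproj_eq1 x : qproj x = gone <-> A x.
Proof.
split=> [/esym|Ax]; first by rewrite -qproj1 => /qproj_eq; rewrite ginv1 gmul1.
by apply/esym; rewrite -qproj1; apply/qproj_eq; rewrite ginv1 gmul1.
Qed.

Definition qimage (D : G -> Prop) (a : quo_group) := exists2 x, D x & qproj x = a.

Lemma qimage_subgroup D : subgroup D -> subgroup (qimage D).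
Proof.
move=> [D1 [DM DV]]; split; first by exists gone.
split; first by move=> _ _ [x Dx <-] [y Dy <-]; exists (gmul x y); [exact: DM | exact: qprojM].
by move=> _ [x Dx <-]; exists (ginv x); [exact: DV | exact: qprojV].
Qed.

(** The section [sval] makes the preimage of [Q] a copy of [Q] times [A]. This turns subgroups of
    [G / A] into data for [quot_sub_order]. *)
Lemma preimage_order (D : G -> Prop) (Q : seq quo_group) : subgroup D -> (forall a, A a -> D a) ->
  finite_set A -> uniq Q -> (forall a, a \in Q -> qimage D a) -> subgroup (fun a => a \in Q) ->
  quot_sub_order A D (fun x => qproj x \in Q) (size Q).
Proof.
move=> [D1 [DM DV]] AD [n /card_isP [lA [uA lAP] _]] uQ QD [Q1 [QM QV]].
split; first split; [by rewrite qproj1 | | split].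
- split; first by move=> x y xQ yQ; rewrite qprojM; exact: QM.
  by move=> x xQ; rewrite qprojV; exact: QV.
- by move=> x Ax; move/qproj_eq1: Ax => ->.
- split.
    move=> x /QD [y Dy /qproj_eq Ayx]; rewrite -(gmulKg y x).
    by apply: DM => //; exact: AD.
  pose f (a : quo_group) (x : G) : G := gmul (sval a) x.
  have pf a x : A x -> qproj (f a x) = a.
    move=> /qproj_eq1 Ax; rewrite qprojM Ax gmulg1; exact: qpi_val.
  apply/card_isP; exists [seq f a x | a <- Q, x <- lA]; last first.
    by rewrite size_allpairs (card_enum (conj uA lAP)).
  split.
    apply: (@allpairs_uniq _ _ _ f Q lA uQ uA).
    have st (z : quo_group * G) : z \in [seq (a, x) | a <- Q, x <- lA] -> A z.2.
      by move=> /allpairsP[[a x] /= [_ xA ->]]; apply/lAP.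
    move=> [a x] [b y] /st/= xA /st/= yA e.
    have ab : a = b by rewrite -(pf a x xA) -(pf b y yA) e.
    by rewrite ab in e *; rewrite (gmul_inj e).
  move=> x; split.
    by move=> /(@allpairsP _ _ _ f)[[a y] /= [aQ /lAP yA ->]]; rewrite pf.
  move=> xQ; apply/(@allpairsP _ _ _ f); exists (qproj x, gmul (ginv (sval (qproj x))) x).
  rewrite /f /= gmulKg; split=> //; apply/lAP.
  case: coset_equiv => _ s _; exact: (s _ _ (rep_rel coset_equiv x)).
Qed.

End Quotient.

(** * Degrees in the quotient of an invariant subtree *)

Section Degrees.
Variables (G : Group) (T : STree) (act : Action G T).
Hypothesis treeT : is_tree T.
Variables (A : G -> Prop) (ty : V T -> Prop).
Hypothesis edgeA : forall g f, A g <-> actE act g f = f.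
Hypothesis ty_act : forall g v, ty v -> ty (actV act g v).
Hypothesis ty_edge : forall f, ty (src f) <-> ~ ty (tgt f).
Variables (H : G -> Prop) (W : V T -> Prop).
Hypothesis sH : subgroup H.
Hypothesis sW : subtree W.
Hypothesis iW : H_invariant act H W.
Variables (lV : seq (V T)) (lE : seq (E T)).
Notation RV := (vH act H).
Notation RE := (eH act H).
Hypothesis lVP : enumerates (reps RV W) lV.
Hypothesis lEP : enumerates (reps RE (subtree_edge W)) lE.
Implicit Types (v w : V T) (e f : E T).

Notation "g *v x" := (actV act g x) (at level 35, right associativity).
Notation "g *e x" := (actE act g x) (at level 35, right associativity).

Let eqV : equiv RV := vH_equiv act sH.
Let eqE : equiv RE := eH_equiv act sH.

Definition degree v := count (fun f => rep RV (src f) == v) lE.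
Definition isdeg v := `[< degenerate act H v >].
Definition contrib v := degree v - 2 * isdeg v.

Lemma W_closed v w : W v -> RV v w -> W w.
Proof. by move=> Wv [h [Hh <-]]; exact: iW. Qed.

Lemma rep_lV v : W v -> rep RV v \in lV.
Proof. by move=> Wv; apply/(proj2 lVP)/reps_rep => //; exact: W_closed. Qed.

Lemma rep_lE e : subtree_edge W e -> rep RE e \in lE.
Proof. by move=> We; apply/(proj2 lEP)/reps_rep => // x y; exact: WE_invar. Qed.

Lemma sum_degree : \sum_(v <- lV) degree v = size lE.
Proof.
rewrite /degree; under eq_bigr do rewrite -sum1_count big_mkcond.
rewrite exchange_big /= -sum1_size [LHS]big_seq [RHS]big_seq; apply: eq_bigr => f.
move=> /(proj2 lEP)[[Ws _] _]; rewrite -big_mkcond /= sum1_count.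
rewrite (@eq_count _ _ (pred1 (rep RV (src f)))); last by move=> v /=; rewrite eq_sym.
by rewrite count_uniq_mem ?rep_lV // (proj1 lVP).
Qed.

Lemma degenerate_closed v w : degenerate act H v -> RV v w -> degenerate act H w.
Proof. by move=> dv [h [Hh <-]]; exact: degenerate_act. Qed.

Lemma nondeg_closed v w : ~ degenerate act H v -> RV v w -> ~ degenerate act H w.
Proof. by case: eqV => _ s _ nd vw dw; apply: nd; apply: degenerate_closed dw (s _ _ vw). Qed.

Lemma n_nondeg_count : n_nondeg act H + count isdeg lV = size lV.
Proof.
have nP : enumerates (reps RV (fun v => ~ degenerate act H v)) [seq v <- lV | ~~ isdeg v].
  split; first exact/filter_uniq/(proj1 lVP).
  move=> v; rewrite mem_filter; split.
    by case/andP => /asboolPn nd /(proj2 lVP) [].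
  move=> [nd rv]; apply/andP; split; first exact/asboolPn.
  apply/(proj2 lVP); split=> //.
  exact: (@nondegenerate_in_subtree _ _ act treeT H).
have -> : n_nondeg act H = size [seq v <- lV | ~~ isdeg v].
  have cl := nondeg_closed.
  apply: (ncls_unique eqV cl).
    apply: epsilon_spec; exists (size [seq v <- lV | ~~ isdeg v]).
    by apply/(nclsP eqV _ cl); exists [seq v <- lV | ~~ isdeg v].
  by apply/(nclsP eqV _ cl); exists [seq v <- lV | ~~ isdeg v].
by rewrite size_filter addnC count_predC.
Qed.

(** Combine [|E| + 2 = 2 r + 2 |V|] with [n_nondeg_count]; the truncations on the two sides
    agree. *)
Lemma Cbar_count : has_hyperbolic act H -> 2 * Cbar_T act H = size lE - 2 * count isdeg lV.
Proof.
move=> hyp; have := rankTH_count treeT ty_act ty_edge sH sW iW lVP lEP.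
rewrite /Cbar_T /C_T; case: excluded_middle_informative => // _.
by have := n_nondeg_count; lia.
Qed.

(** At a degenerate vertex the stabilizer in [H] lies in [A] and fixes every edge, so distinct edges
    at [v] are inequivalent. [tr] moves a representative to one starting at [v]. *)
Lemma star_enum v : rep RV v = v -> degenerate act H v ->
  exists2 l, enumerates (fun f => subtree_edge W f /\ src f = v) l & size l = degree v.
Proof.
move=> rv dv.
have HA : forall h, H h -> h *v v = v -> A h.
  by apply/(degenerateP treeT edgeA) => //; case: dv => e [ev _]; exists e.
pose tr f := if pselect (exists h, H h /\ h *v src f = v) is left ex
  then actE act (sval (cid ex)) f else f.
have trP f : rep RV (src f) = v -> RE f (tr f) /\ src (tr f) = v.
  move=> rf; rewrite /tr; case: pselect => [ex|[]].
    by case: cid => h [Hh hf] /=; split; [exists h | rewrite act_src].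
  by have := rep_rel eqV (src f); rewrite rf.
pose s := [seq f <- lE | rep RV (src f) == v].
have sP f : f \in s -> [/\ rep RV (src f) = v, subtree_edge W f & rep RE f = f].
  by rewrite mem_filter => /andP[/eqP rf /(proj2 lEP)[]].
exists (map tr s); last by rewrite size_map size_filter.
split.
  rewrite map_inj_in_uniq ?filter_uniq ?(proj1 lEP) //.
  move=> f g /sP[fv _ rf] /sP[gv _ rg] fg; rewrite -rf -rg.
  apply: rep_eq => //; have [r1 _] := trP _ fv; have [r2 _] := trP _ gv.
  by case: eqE => _ sy t; apply: t r1 _; rewrite fg; exact: sy.
move=> f; split.
  move=> /mapP[g /sP[gv Wg rg] ->]; have [r1 st] := trP _ gv; split=> //.
  exact: WE_invar iW _ _ Wg r1.
move=> [Wf fv]; have fs : rep RE f \in s.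
  rewrite mem_filter rep_lE // andbT -(rep_eq eqV (eH_src (rep_rel eqE f))) fv rv.
  by rewrite eqxx.
apply/mapP; exists (rep RE f) => //.
have [rg _ _] := sP _ fs; have [r1 st] := trP _ rg.
have [h [Hh hf]] : RE f (tr (rep RE f)) by case: eqE => _ _ t; apply: t r1; exact: rep_rel.
rewrite -hf; apply/esym/edgeA; apply: HA => //.
by rewrite -{1}fv -act_src hf.
Qed.

Hypothesis minW : forall W', subtree W' -> H_invariant act H W' -> (forall v, W' v -> W v) ->
  forall v, W v -> W' v.
Hypothesis hypH : has_hyperbolic act H.

(** Were there at most one edge at [v], deleting the orbit of [v] from [W] would leave a smaller
    invariant subtree: a path through the orbit would use two distinct edges there. *)
Lemma degree_ge2 v : v \in lV -> degenerate act H v -> 2 <= degree v.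
Proof.
move=> /(proj2 lVP) [Wv rv] dv; have [l [ul lP] <-] := star_enum rv dv.
rewrite leqNgt; apply/negP => l1.
have uni e f : subtree_edge W e -> subtree_edge W f -> src e = v -> src f = v -> e = f.
  move=> We Wf ev fv; have el : e \in l by apply/lP.
  have fl : f \in l by apply/lP.
  case: l l1 el fl {ul lP} => [|a [|]] // _; rewrite !inE => /eqP -> /eqP -> //.
case: (eqV) => RVr RVs RVt.
pose W' x := W x /\ ~ RV v x.
suff : forall x, W x -> W' x by move=> /(_ v Wv) [_]; apply; exact: RVr.
apply: (@minW W'); [|  | by move=> x []]; last first.
  move=> h x Hh [Wx nx]; split; first exact: iW.
  by move=> vx; apply: nx; apply: RVt vx _; apply: RVs; exists h.
apply: (subtree_connected treeT).
  (* The remainder is nonempty: a neighbour of [v] has the other colour, so it is not in the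
     orbit. *)
  have [g [Hg hg]] := hypH.
  have [e ev ne] : exists2 e, src e = v & ~ side e (g *v v).
    by apply: (toward treeT) => e; apply: (hg v).
  have Wt : W (tgt e) by apply: (subtree_toward treeT sW _ _ ne); rewrite ?ev //; exact: iW.
  exists (tgt e); split=> // -[h [_ hv]].
  by have := ty_edge e; rewrite -hv ev (ty_actE ty_act); tauto.
move=> e x [Ws nvs] [Wx nvx] ne.
have Wt : W (tgt e) by exact: (subtree_toward treeT sW Ws Wx ne).
split=> // -[h [Hh hv]].
have [f fs nf] : exists2 f, src f = tgt e & ~ side f x.
  by apply: (toward treeT) => tx; apply: nvx; exists h; rewrite hv.
have nef : erev e <> f by move=> ef; apply: nf; rewrite -ef; apply/(sideN treeT).
have Wf : subtree_edge W f.
  by split; rewrite ?fs //; apply: (subtree_toward treeT sW _ Wx nf); rewrite fs.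
have We : subtree_edge W (erev e) by split; rewrite ?tgt_rev.
have Hh' : H (ginv h) by case: sH => _ [_]; apply.
have tr g : subtree_edge W g -> subtree_edge W (ginv h *e g).
  by move=> Wg; exact: (WE_invar iW Wg (eH_act act g Hh')).
apply: nef; apply: (@actE_inj _ _ act (ginv h)); apply: uni; try exact: tr.
  by rewrite act_src -/(tgt e) -hv actVK.
by rewrite act_src fs -hv actVK.
Qed.

Lemma sum_contrib : \sum_(v <- lV) contrib v = 2 * Cbar_T act H.
Proof.
rewrite (Cbar_count hypH) -sum_degree.
have -> : count isdeg lV = \sum_(v <- lV) isdeg v.
  by rewrite -sum1_count big_mkcond; apply: eq_bigr => v _; case: (isdeg v).
have -> : \sum_(v <- lV) degree v = \sum_(v <- lV) contrib v + 2 * \sum_(v <- lV) isdeg v.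
  rewrite big_distrr -big_split /= [LHS]big_seq [RHS]big_seq; apply: eq_bigr => v vl.
  rewrite /contrib subnK // /isdeg; case: asboolP => // dv.
  by rewrite muln1; exact: degree_ge2.
by rewrite addnK.
Qed.

End Degrees.

Lemma count_fibers (X Y : eqType) (a : pred X) (s : seq X) (t : seq Y) (phi : X -> Y) m :
  (forall x, x \in s -> a x -> phi x \in t) ->
  (forall y, y \in t -> count (fun x => a x && (phi x == y)) s <= m) ->
  count a s <= m * size t.
Proof.
move=> at_ fib; rewrite -sum_const_seq -sum1_count.
apply: (@leq_trans (\sum_(x <- s | a x) \sum_(y <- t) (phi x == y))).
  rewrite big_seq_cond [leqRHS]big_seq_cond; apply: leq_sum => x /andP[xs ax].
  rewrite (big_rem _ (at_ _ xs ax)) /= eqxx; exact: leq_addr.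
rewrite exchange_big /=; apply: leq_sum_seq => y yt; apply: leq_trans (fib _ yt).
rewrite -sum1_count big_mkcond [leqRHS]big_mkcond; apply: leq_sum => x _ /=.
by case: (a x); case: eqP.
Qed.

Lemma sum_fibers (X Y : eqType) (s : seq X) (phi : X -> Y) (F : Y -> nat) m :
  (forall y, count (fun x => phi x == y) s <= m) ->
  \sum_(x <- s) F (phi x) <= m * \sum_(y <- undup (map phi s)) F y.
Proof.
move=> fib.
apply: (@leq_trans (\sum_(x <- s) \sum_(y <- undup (map phi s)) (phi x == y) * F y)).
  apply: leq_sum_seq => x xs; rewrite (big_rem (phi x)) /= ?mem_undup ?map_f //.
  by rewrite eqxx mul1n leq_addr.
rewrite exchange_big big_distrr /=; apply: leq_sum => y _.
rewrite -big_distrl leq_mul2r /= (leq_trans _ (fib y)) ?orbT //.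
by rewrite -sum1_count [leqRHS]big_mkcond; apply: leq_sum => x _; case: eqP.
Qed.

(** * Fibers over pairs of classes *)

Section Fibers.
Variables (G : Group) (A H K : G -> Prop).
Hypotheses (sA : subgroup A) (sH : subgroup H) (sK : subgroup K) (finA : finite_set A).

(** Fixing [x0], send [x] to [h(x0)^-1 h(x) k(x)^-1 k(x0)]. It lies in [A] and in [HK], and it
    determines [h(x) k(x)^-1], hence [x]. *)
Lemma fiber_bound (X : eqType) (s : seq X) (h k : X -> G) : uniq s ->
  (forall x, x \in s -> H (h x)) -> (forall x, x \in s -> K (k x)) ->
  (forall x y, x \in s -> y \in s ->
     A (gmul (ginv (h y)) (gmul (gmul (h x) (ginv (k x))) (k y)))) ->
  (forall x y, x \in s -> y \in s ->
     gmul (h x) (ginv (k x)) = gmul (h y) (ginv (k y)) -> x = y) ->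
  size s <= card (setI A (setM H K)).
Proof.
move=> us Hh Kk hA inj.
have [n /card_isP [lA [uA lAP] _]] := finA.
have [l lP] : exists l, enumerates (setI A (setM H K)) l.
  by apply: (@enumerates_bounded _ _ lA) => x [/lAP].
rewrite (card_enum lP); case: s us Hh Kk hA inj => [//|x0 s] us Hh Kk hA inj.
have x0s : x0 \in x0 :: s by rewrite inE eqxx.
have [_ [HM HV]] := sH; have [_ [KM KV]] := sK.
rewrite -(count_predT (x0 :: s)).
apply: (leq_count_inj (f := fun x =>
  gmul (ginv (h x0)) (gmul (gmul (h x) (ginv (k x))) (k x0)))) => //.
  by move=> x y xs ys _ _ /gmul_inj /gmul_injr; exact: inj.
move=> x xs _; apply/(proj2 lP); split; first exact: hA.
exists (gmul (ginv (h x0)) (h x)), (gmul (ginv (k x)) (k x0)); split; last split.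
- by apply: HM; [apply/HV/Hh | exact: Hh].
- by apply: KM; [apply/KV/Kk | exact: Kk].
- by rewrite !gmulA.
Qed.

End Fibers.

(** * Vertices of [T_L/L] above a pair of vertex classes *)

Section Pair.
Variables (G : Group) (T : STree) (act : Action G T).
Hypothesis treeT : is_tree T.
Variables (A : G -> Prop) (ty : V T -> Prop).
Hypotheses (sA : subgroup A) (nA : normal A) (finA : finite_set A).
Hypothesis edgeA : forall g f, A g <-> actE act g f = f.
Variables (H K : G -> Prop) (sH : subgroup H) (sK : subgroup K).
Notation L := (setI H K).
Notation m := (card (setI A (setM H K))).
Implicit Types (v w x y : V T) (e f : E T).

Notation "g *v x" := (actV act g x) (at level 35, right associativity).
Notation "g *e x" := (actE act g x) (at level 35, right associativity).

Lemma setI_subgroup : subgroup L.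
Proof.
have [H1 [HM HV]] := sH; have [K1 [KM KV]] := sK; split=> //; split.
  by move=> x y [? ?] [? ?]; split; auto.
by move=> x [? ?]; split; auto.
Qed.
Let sL := setI_subgroup.

(** If [h f = f1] and [k f = f2], then [h k^-1] sends [f2] to [f1], which fixes it modulo [A]. Equal
    values of [h k^-1] for two edges give an element of [H] and [K] relating them. *)
Lemma edge_fiber (s : seq (E T)) f1 f2 : uniq s ->
  (forall f, f \in s -> [/\ rep (eH act L) f = f, eH act H f f1 & eH act K f f2]) ->
  size s <= m.
Proof.
move=> us sP.
have ex f : exists hk : G * G, f \in s -> [/\ H hk.1, K hk.2, hk.1 *e f = f1 & hk.2 *e f = f2].
  have [fs|nf] := boolP (f \in s); last by exists (gone, gone).
  by have [_ [h [Hh hf]] [k [Kk kf]]] := sP _ fs; exists (h, k).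
have [hk hkP] := choice ex.
apply: (fiber_bound sH sK finA (h := fun f => (hk f).1) (k := fun f => (hk f).2)) => //.
- by move=> x /hkP[].
- by move=> x /hkP[].
- move=> x y /hkP[_ _ hx kx] /hkP[_ _ hy ky]; apply/(edgeA _ y).
  by rewrite !actEM ky -kx actEK hx -hy actEK.
- move=> x y xs ys e; have [rx _ _] := sP _ xs; have [ry _ _] := sP _ ys.
  have [Hx Kx hx kx] := hkP _ xs; have [Hy Ky hy ky] := hkP _ ys.
  have [_ [HM HV]] := sH; have [_ [KM KV]] := sK.
  rewrite -rx -ry; apply: rep_eq; first exact: eH_equiv.
  exists (gmul (ginv (hk y).1) (hk x).1); split; last by rewrite actEM hx -hy actEK.
  split; first by apply: HM => //; exact: HV.
  have -> : (hk x).1 = gmul (gmul (hk y).1 (ginv (hk y).2)) (hk x).2.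
    by rewrite -e -gmulA gmulV gmulg1.
  by rewrite -gmulA gmulVg; apply: KM => //; exact: KV.
Qed.

(** Vertex stabilizers may exceed [A], so here the agreement of the [h k^-1] modulo [A] has to be
    assumed. *)
Lemma vertex_fiber (s : seq (V T)) v w (hk : V T -> G * G) : uniq s ->
  (forall x, x \in s -> rep (vH act L) x = x) ->
  (forall x, x \in s -> [/\ H (hk x).1, K (hk x).2, (hk x).1 *v x = v & (hk x).2 *v x = w]) ->
  (forall x y, x \in s -> y \in s ->
     A (gmul (ginv (hk y).1) (gmul (gmul (hk x).1 (ginv (hk x).2)) (hk y).2))) ->
  size s <= m.
Proof.
move=> us rs hkP hA.
apply: (fiber_bound sH sK finA (h := fun x => (hk x).1) (k := fun x => (hk x).2)) => //.
- by move=> x /hkP[].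
- by move=> x /hkP[].
- move=> x y xs ys e.
  have [Hx Kx hx kx] := hkP _ xs; have [Hy Ky hy ky] := hkP _ ys.
  have [_ [HM HV]] := sH; have [_ [KM KV]] := sK.
  rewrite -(rs _ xs) -(rs _ ys); apply: rep_eq; first exact: vH_equiv.
  exists (gmul (ginv (hk y).1) (hk x).1); split; last by rewrite actVM hx -hy actVK.
  split; first by apply: HM => //; exact: HV.
  have -> : (hk x).1 = gmul (gmul (hk y).1 (ginv (hk y).2)) (hk x).2.
    by rewrite -e -gmulA gmulV gmulg1.
  by rewrite -gmulA gmulVg; apply: KM => //; exact: KV.
Qed.

Variables (WH WK WL : V T -> Prop).
Hypotheses (iWH : H_invariant act H WH) (iWK : H_invariant act K WK).
Hypothesis iWL : H_invariant act L WL.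
Hypotheses (WLH : forall x, WL x -> WH x) (WLK : forall x, WL x -> WK x).
Variables (lVH lVK : seq (V T)) (lEH lEK : seq (E T)).
Hypothesis lVHP : enumerates (reps (vH act H) WH) lVH.
Hypothesis lVKP : enumerates (reps (vH act K) WK) lVK.
Hypothesis lEHP : enumerates (reps (eH act H) (subtree_edge WH)) lEH.
Hypothesis lEKP : enumerates (reps (eH act K) (subtree_edge WK)) lEK.

Let eVH := vH_equiv act sH.
Let eVK := vH_equiv act sK.
Let eVL := vH_equiv act sL.
Let eEH := eH_equiv act sH.
Let eEK := eH_equiv act sK.

Lemma WE_LH f : subtree_edge WL f -> subtree_edge WH f.
Proof. by move=> [/WLH ? /WLH ?]. Qed.

Lemma WE_LK f : subtree_edge WL f -> subtree_edge WK f.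
Proof. by move=> [/WLK ? /WLK ?]. Qed.

(** Over finitely many pairs with at most [m] classes each, lists of inequivalent edges have bounded
    length. Tameness of the intersection rests on this. *)
Lemma edges_finite : exists l, enumerates (reps (eH act L) (subtree_edge WL)) l.
Proof.
apply: contrapT => no.
pose S := reps (eH act L) (subtree_edge WL).
have bnd (s : seq (E T)) : uniq s -> (forall f, f \in s -> S f) ->
    size s <= m * (size [seq (a, b) | a <- lEH, b <- lEK]).
  move=> us sS; rewrite -(count_predT s).
  apply: (count_fibers (phi := fun f => (rep (eH act H) f, rep (eH act K) f))).
    move=> f fs _; have [Wf _] := sS _ fs; apply/allpairsP.
    exists (rep (eH act H) f, rep (eH act K) f); split=> //=.
      by apply: (rep_lE sH iWH lEHP); exact: WE_LH.
    by apply: (rep_lE sK iWK lEKP); exact: WE_LK.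
  move=> [f1 f2] _; rewrite -size_filter; apply: (@edge_fiber _ f1 f2); first exact: filter_uniq.
  move=> f; rewrite mem_filter => /andP[/eqP[<- <-] /sS [_ rf]].
  by split=> //; exact: rep_rel.
set N := (m * _) in bnd.
have grow n : exists s : seq (E T), [/\ uniq s, forall f, f \in s -> S f & size s = n].
  elim: n => [|n [s [us sS sn]]]; first by exists [::].
  have [f Sf nf] : exists2 f, S f & f \notin s.
    apply: contrapT => nof; apply: no; exists s; split=> // f; split; first exact: sS.
    move=> Sf; apply: contrapT => /negP nf; apply: nof; by exists f.
  exists (f :: s); split; [by rewrite /= nf | | by rewrite /= sn].
  by move=> g; rewrite inE => /predU1P[->|/sS].
by have [s [us sS sN]] := grow N.+1; have := bnd _ us sS; rewrite sN ltnn.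
Qed.

Variables (lVL : seq (V T)) (lEL : seq (E T)).
Hypothesis lVLP : enumerates (reps (vH act L) WL) lVL.
Hypothesis lELP : enumerates (reps (eH act L) (subtree_edge WL)) lEL.

Variables v w : V T.
Hypotheses (vl : v \in lVH) (wl : w \in lVK).
Definition over_pair := [seq x <- lVL | (rep (vH act H) x == v) && (rep (vH act K) x == w)].
Notation xs := over_pair.
Notation dH := (degree act H lEH v).
Notation dK := (degree act K lEK w).
Notation dL x := (degree act L lEL x).

Lemma over_pairP x : x \in xs -> [/\ WL x, rep (vH act L) x = x, vH act H x v & vH act K x w].
Proof.
rewrite mem_filter => /andP[/andP[/eqP <- /eqP <-] /(proj2 lVLP) [Wx rx]].
by split=> //; exact: rep_rel.
Qed.

Lemma over_pair_uniq : uniq xs.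
Proof. exact/filter_uniq/(proj1 lVLP). Qed.

Lemma over_pair_degrees : \sum_(x <- xs) dL x <= m * (dH * dK).
Proof.
pose a f := (rep (vH act H) (src f) == v) && (rep (vH act K) (src f) == w).
apply: (@leq_trans (count a lEL)).
  rewrite /degree; under eq_bigr do rewrite -sum1_count big_mkcond.
  rewrite exchange_big /= -sum1_count [leqRHS]big_mkcond; apply: leq_sum => f _.
  rewrite -big_mkcond sum1_count; case af: (a f); last first.
    rewrite leqNgt -has_count; apply/hasPn => x.
    rewrite mem_filter => /andP[ax _]; apply/eqP => e; move: af ax; rewrite /a -e.
    have r := rep_rel eVL (src f).
    have rH : vH act H (src f) (rep (vH act L) (src f)) by case: r => l [[Hl _] <-]; exists l.
    have rK : vH act K (src f) (rep (vH act L) (src f)) by case: r => l [[_ Kl] <-]; exists l.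
    by rewrite -(rep_eq eVH rH) -(rep_eq eVK rK) => ->.
  rewrite (@eq_count _ _ (pred1 (rep (vH act L) (src f)))); last by move=> x /=; rewrite eq_sym.
  by rewrite count_uniq_mem ?over_pair_uniq //; case: (_ \in _).
pose stH := [seq f <- lEH | rep (vH act H) (src f) == v].
pose stK := [seq f <- lEK | rep (vH act K) (src f) == w].
have -> : dH * dK = size [seq (a, b) | a <- stH, b <- stK] by rewrite size_allpairs !size_filter.
apply: (count_fibers (phi := fun f => (rep (eH act H) f, rep (eH act K) f))).
  move=> f /(proj2 lELP) [Wf _] /andP[fv fw]; apply/allpairsP.
  exists (rep (eH act H) f, rep (eH act K) f); split=> //=.
    rewrite mem_filter (rep_lE sH iWH lEHP) ?andbT; last exact: WE_LH.
    by rewrite -(rep_eq eVH (eH_src (rep_rel eEH f))).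
  rewrite mem_filter (rep_lE sK iWK lEKP) ?andbT; last exact: WE_LK.
  by rewrite -(rep_eq eVK (eH_src (rep_rel eEK f))).
move=> [f1 f2] _; rewrite -size_filter; apply: (@edge_fiber _ f1 f2).
  exact/filter_uniq/(proj1 lELP).
move=> f; rewrite mem_filter => /andP[/andP[_ /eqP[<- <-]] /(proj2 lELP) [_ rf]].
by split=> //; exact: rep_rel.
Qed.

Hypotheses (sWH : subtree WH) (sWL : subtree WL) (sWK : subtree WK).

Lemma degenerate_restrict (H' : G -> Prop) x y : (forall g, L g -> H' g) -> subgroup H' ->
  vH act H' x y -> degenerate act H' y -> degenerate act L x.
Proof.
move=> LH' sH' xy dy.
have dx : degenerate act H' x.
  by apply: degenerate_closed dy _ => //; case: (vH_equiv act sH') => _ sy _; exact: sy.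
have ex : exists f, src f = x by case: dx => f [fx _]; exists f.
apply/(degenerateP treeT edgeA) => // h /LH' Hh; move: h Hh.
by apply/(degenerateP treeT edgeA).
Qed.

Lemma degree_restrict (H' : G -> Prop) (W' : V T -> Prop) l' x y : (forall g, L g -> H' g) ->
  subgroup H' -> H_invariant act H' W' -> (forall z, WL z -> W' z) ->
  enumerates (reps (eH act H') (subtree_edge W')) l' -> rep (vH act H') y = y ->
  degenerate act H' y -> rep (vH act L) x = x -> vH act H' x y -> dL x <= degree act H' l' y.
Proof.
move=> LH' sH' iW' WL' l'P ry dy rx xy.
have dx := degenerate_restrict LH' sH' xy dy.
have [l lP <-] := star_enum treeT edgeA sL iWL lELP rx dx.
have [l1 l1P <-] := star_enum treeT edgeA sH' iW' l'P ry dy.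
case: xy => h [Hh hx].
rewrite -(size_map (actE act h)); apply: uniq_leq_size.
  by rewrite map_inj_uniq ?(proj1 lP) // => f f'; exact: actE_inj.
move=> _ /mapP[f /(proj2 lP)[[Ws Wt] fx] ->]; apply/(proj2 l1P); split.
  by apply: (WE_invar iW' _ (eH_act act f Hh)); split; exact: WL'.
by rewrite act_src fx.
Qed.

Notation cH := (contrib act H lEH v).
Notation cK := (contrib act K lEK w).
Notation cL x := (contrib act L lEL x).

(** As in [excess_trivial]: [b (t - 2) <= t (b - 2)] for [t <= b], summed and divided by [b]. *)
Lemma contrib_le (a b n : nat) (f : V T -> nat) :
  (forall x, x \in xs -> f x <= b) -> \sum_(x <- xs) f x <= n * (a * b) ->
  \sum_(x <- xs) (f x - 2) <= n * (a * (b - 2)).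
Proof.
move=> fb sb; case: (posnP b) => [b0|b0].
  rewrite big_seq big1 // => x /fb; rewrite b0; lia.
rewrite -(leq_pmul2l b0) big_distrr /=.
apply: (@leq_trans (\sum_(x <- xs) f x * (b - 2))).
  by apply: leq_sum_seq => x /fb; nia.
rewrite -big_distrl /=.
have -> : b * (n * (a * (b - 2))) = n * (a * b) * (b - 2) by rewrite mulnCA !mulnA -!mulnA (mulnCA b) !mulnA.
by rewrite leq_mul2r sb orbT.
Qed.

Lemma contrib_nondeg_nondeg : ~ degenerate act H v -> ~ degenerate act K w ->
  \sum_(x <- xs) cL x <= m * (cH * cK).
Proof.
move=> nv nw; rewrite /contrib /isdeg !(asboolF nv) !(asboolF nw) !muln0 !subn0.
apply: leq_trans over_pair_degrees; apply: leq_sum => x _; exact: leq_subr.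
Qed.

Let LH g : L g -> H g. Proof. by case. Qed.
Let LK g : L g -> K g. Proof. by case. Qed.

Lemma over_pair_H x : x \in xs -> degenerate act H v ->
  degenerate act L x /\ dL x <= dH.
Proof.
move=> /over_pairP[_ rx xv _] dv; split; first exact: degenerate_restrict xv dv.
apply: (degree_restrict LH sH iWH WLH lEHP) => //.
by have [] := proj1 (proj2 lVHP v) vl.
Qed.

Lemma over_pair_K x : x \in xs -> degenerate act K w ->
  degenerate act L x /\ dL x <= dK.
Proof.
move=> /over_pairP[_ rx _ xw] dw; split; first exact: degenerate_restrict xw dw.
apply: (degree_restrict LK sK iWK WLK lEKP) => //.
by have [] := proj1 (proj2 lVKP w) wl.
Qed.

Lemma sum_contrib_deg : (forall x, x \in xs -> degenerate act L x) ->
  \sum_(x <- xs) cL x = \sum_(x <- xs) (dL x - 2).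
Proof.
move=> dx; rewrite [LHS]big_seq [RHS]big_seq; apply: eq_bigr => x /dx d.
by rewrite /contrib /isdeg (asboolT d) muln1.
Qed.

Lemma contrib_nondeg_deg : ~ degenerate act H v -> degenerate act K w ->
  \sum_(x <- xs) cL x <= m * (cH * cK).
Proof.
move=> nv dw; rewrite sum_contrib_deg => [|x /over_pair_K /(_ dw) []//].
rewrite /contrib /isdeg (asboolF nv) (asboolT dw) muln0 muln1 subn0.
by apply: contrib_le over_pair_degrees => x /over_pair_K /(_ dw) [].
Qed.

Lemma contrib_deg_nondeg : degenerate act H v -> ~ degenerate act K w ->
  \sum_(x <- xs) cL x <= m * (cH * cK).
Proof.
move=> dv nw; rewrite sum_contrib_deg => [|x /over_pair_H /(_ dv) []//].
rewrite /contrib /isdeg (asboolF nw) (asboolT dv) muln0 muln1 subn0 [X in m * X]mulnC.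
apply: contrib_le; first by move=> x /over_pair_H /(_ dv) [].
by rewrite [dK * _]mulnC; exact: over_pair_degrees.
Qed.

Hypotheses (dv : degenerate act H v) (dw : degenerate act K w).
Hypotheses (dH2 : 2 <= dH) (dK2 : 2 <= dK).

Lemma gluing_maps : exists hk : V T -> G * G, forall x, x \in xs ->
  [/\ H (hk x).1, K (hk x).2, (hk x).1 *v x = v & (hk x).2 *v x = w].
Proof.
have ex x : exists hk : G * G, x \in xs -> [/\ H hk.1, K hk.2, hk.1 *v x = v & hk.2 *v x = w].
  have [xsx|nx] := boolP (x \in xs); last by exists (gone, gone).
  by have [_ _ [h [Hh hx]] [k [Kk kx]]] := over_pairP xsx; exists (h, k).
by have [hk hkP] := choice ex; exists hk.
Qed.

(* For the translates of [u0]. *)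
Lemma contrib_deg_deg_A : (forall g x, x \in xs -> g *v x = x -> A g) ->
  \sum_(x <- xs) cL x <= m * (cH * cK).
Proof.
move=> stA; have [hk hkP] := gluing_maps.
have sz : size xs <= m.
  apply: (vertex_fiber (hk := hk) over_pair_uniq _ hkP); first by move=> x /over_pairP[].
  move=> x y xsx ysy; apply: (stA _ y) => //.
  have [_ _ hx kx] := hkP _ xsx; have [_ _ hy ky] := hkP _ ysy.
  by rewrite !actVM ky -kx actVK hx -hy actVK.
(* At most [m] terms, each at most [c(v) c(w)]: a positive [c(x)] is bounded by both factors, which
   are then at least 1. *)
apply: (@leq_trans (\sum_(x <- xs) cH * cK)); last by rewrite sum_const_seq mulnC leq_mul2r sz orbT.
apply: leq_sum_seq => x xsx; have [dx xH] := over_pair_H xsx dv; have [_ xK] := over_pair_K xsx dw.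
rewrite /contrib /isdeg (asboolT dv) (asboolT dw) (asboolT dx) !muln1.
move: xH xK; move: (dL x) dH dK => a b c ab ac.
case: (leqP a 2) => [a2|a3]; first by have -> : a - 2 = 0 by lia.
by apply: (@leq_trans ((b - 2) * 1)); [lia | rewrite leq_mul2l; lia].
Qed.

Variables (u : V T) (eps : E T) (p q : nat).
Notation Gu := (fun g => g *v u = u).
Hypotheses (eps_src : src eps = u).
Hypothesis eps_trans : forall g f, src f = g *v u -> exists g', f = g' *e eps.
Hypotheses (q_gt0 : 0 < q) (le_qp : q <= p).
Hypothesis order_bound : forall D n, quot_sub_order A Gu D n -> 3 <= n -> q * n <= p * (n - 2).
Variables (gv gw : G).
Hypotheses (gvu : v = gv *v u) (gwu : w = gw *v u).

Notation Q := (quo_group sA nA).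
Notation pr := (qproj sA nA).
Notation img := (@qimage G A sA nA).

Lemma Gu_subgroup : subgroup Gu.
Proof.
split; first exact: actV1.
by split=> [x y xu yu|x xu]; [rewrite actVM yu | rewrite -{1}xu actVK].
Qed.

(** Edges in the orbit of [eps] correspond to elements of [G / A] through [gam]. Pulled back to [u]
    by [gv] and [gw], the stars of [v] and [w] become finite sets [X] and [Y] in the image of the
    stabilizer of [u]. *)
Lemma contrib_deg_deg_u : q * \sum_(x <- xs) cL x <= p * (m * (cH * cK)).
Proof.
have [hk hkP] := gluing_maps.
have exg f : exists g, (exists g', f = g' *e eps) -> f = g *e eps.
  by have [[g fg]|n] := EM (exists g', f = g' *e eps); [exists g | exists gone].
have [gam gamP] := choice exg.
have gamE g f : f = g *e eps -> pr (gam f) = pr g.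
  move=> fg; have fg' := gamP f (ex_intro _ g fg).
  apply/qproj_eq/(edgeA _ eps); by rewrite actEM -fg {2}fg' actEK.
have [_ rv] : WH v /\ rep (vH act H) v = v by move: vl => /(proj2 lVHP).
have [_ rw] : WK w /\ rep (vH act K) w = w by move: wl => /(proj2 lVKP).
have [sv svP szv] := star_enum treeT edgeA sH iWH lEHP rv dv.
have [sw swP szw] := star_enum treeT edgeA sK iWK lEKP rw dw.
have lift f g : src f = g *v u -> exists g', f = g' *e eps := @eps_trans g f.
have inj g s : uniq s -> (forall f, f \in s -> exists g', f = g' *e eps) ->
    uniq (map (fun f => gmul (pr g) (pr (gam f))) s).
  move=> us sE; rewrite map_inj_in_uniq // => f f' /sE fe /sE f'e /gmul_inj /qproj_eq /edgeA e.
  by rewrite (gamP _ fe) (gamP _ f'e) -{1}(e eps) actEM actEKV.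
have starD g y s : y = g *v u -> uniq s -> (forall f, f \in s -> src f = y) ->
    inD (img Gu) (map (fun f => gmul (pr (ginv g)) (pr (gam f))) s).
  move=> yg us sy; split; first by apply: inj => // f /sy fy; apply: (lift _ g); rewrite fy.
  move=> _ /mapP[f /sy fy ->]; exists (gmul (ginv g) (gam f)); last exact: qprojM.
  have /gamP fe : exists g', f = g' *e eps by apply: (lift _ g); rewrite fy.
  by rewrite actVM -{1}eps_src -act_src -fe fy yg actVK.
pose X := map (fun f => gmul (pr (ginv gv)) (pr (gam f))) sv.
pose Y := map (fun f => gmul (pr (ginv gw)) (pr (gam f))) sw.
have iX : inD (img Gu) X by apply: (starD _ v) => //; [exact: (proj1 svP) | move=> f /(proj2 svP)[]].
have iY : inD (img Gu) Y by apply: (starD _ w) => //; [exact: (proj1 swP) | move=> f /(proj2 swP)[]].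
have sI := qimage_subgroup sA nA Gu_subgroup.
(* For an edge [f] at [x], the elements of [X] and [Y] given by its images at [v] and [w] have the
   fixed quotient [phi x], so the degree of [x] is at most the number of representations of
   [phi x]. *)
pose phi x : Q := pr (gmul (ginv gv) (gmul (gmul (hk x).1 (ginv (hk x).2)) gw)).
have dLe x : x \in xs -> dL x <= nrep X (map ginv Y) (phi x).
  move=> xsx; have [Hx Kx hx kx] := hkP _ xsx; have [Wx rx _ _] := over_pairP xsx.
  have [dx _] := over_pair_H xsx dv.
  have [l lP <-] := star_enum treeT edgeA sL iWL lELP rx dx.
  rewrite nrep_map_inv -size_filter.
  rewrite -(size_map (fun f => gmul (pr (ginv gw)) (pr (gam ((hk x).2 *e f))))).
  have xg : x = gmul (ginv (hk x).1) gv *v u by rewrite actVM -gvu -hx actVK.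
  have le f : f \in l -> exists g', f = g' *e eps.
    by move=> /(proj2 lP) [_ fx]; apply: (lift _ (gmul (ginv (hk x).1) gv)); rewrite fx.
  have gk k f : f \in l -> pr (gam (k *e f)) = gmul (pr k) (pr (gam f)).
    by move=> /le /gamP fe; rewrite -qprojM; apply: gamE; rewrite actEM -fe.
  apply: uniq_leq_size.
    rewrite map_inj_in_uniq ?(proj1 lP) // => f f' fl f'l /gmul_inj.
    rewrite !gk // => /gmul_inj /qproj_eq /edgeA e.
    by rewrite (gamP _ (le _ fl)) (gamP _ (le _ f'l)) -{1}(e eps) actEM actEKV.
  move=> _ /mapP[f fl ->]; have [/WE_LK Wk fx] := proj1 (proj2 lP f) fl.
  have [/WE_LH Wh _] := proj1 (proj2 lP f) fl.
  rewrite mem_filter; apply/andP; split; last first.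
    apply: map_f; apply/(proj2 swP); split; last by rewrite act_src fx.
    exact: (WE_invar iWK Wk (eH_act act f Kx)).
  have -> : gmul (phi x) (gmul (pr (ginv gw)) (pr (gam ((hk x).2 *e f)))) =
      gmul (pr (ginv gv)) (pr (gam ((hk x).1 *e f))).
    rewrite !gk // /phi !qprojM !qprojV -!gmulA; congr gmul; congr gmul.
    by rewrite gmulKg gmulVg.
  apply: map_f; apply/(proj2 svP); split; last by rewrite act_src fx.
  exact: (WE_invar iWH Wh (eH_act act f Hx)).
rewrite sum_contrib_deg => [|x /over_pair_H /(_ dv) []//].
(* A common value of [phi] means that the [h k^-1] agree modulo [A], as [vertex_fiber] requires. *)
have fib (y : Q) : count (fun x => phi x == y) xs <= m.
  rewrite -size_filter; apply: (@vertex_fiber _ v w hk); first exact/filter_uniq/over_pair_uniq.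
  - by move=> x; rewrite mem_filter => /andP[_ /over_pairP[]].
  - by move=> x; rewrite mem_filter => /andP[_ /hkP].
  move=> x x'; rewrite !mem_filter => /andP[/eqP e _] /andP[/eqP e' _].
  apply/(qproj_eq1 sA nA); move: e; rewrite -e' /phi !qprojM !qprojV => /gmul_inj /gmul_injr e.
  by rewrite e gmulA gmulA gmulV gmul1 gmulV.
have le1 : \sum_(x <- xs) (dL x - 2) <= m * excess X (map ginv Y).
  apply: (@leq_trans (\sum_(x <- xs) (nrep X (map ginv Y) (phi x) - 2))).
    by apply: leq_sum_seq => x /dLe; lia.
  apply: leq_trans (sum_fibers (fun y : Q => nrep X (map ginv Y) y - 2) fib) _.
  by rewrite leq_mul2l leq_excess ?orbT // undup_uniq.
have sX : size X = dH by rewrite size_map.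
have sY : size (map ginv Y) = dK by rewrite !size_map.
have AGu a : A a -> a *v u = u by move=> Aa; exact: (kernel_act treeT edgeA).
have := excess_bound sI q_gt0 le_qp _ iX (inD_inv sI iY).
rewrite sX sY => /(_ _ dH2 dK2) eb.
rewrite /contrib /isdeg (asboolT dv) (asboolT dw) !muln1.
apply: leq_trans (leq_mul (leqnn q) le1) _; rewrite mulnCA [leqRHS]mulnCA leq_mul2l; apply/orP; right.
apply: eb => Qs uQ QD sQ Q3; apply: (order_bound _ Q3).
exact: (preimage_order Gu_subgroup AGu finA uQ QD sQ).
Qed.

End Pair.

(** * The constant [theta] *)

Section Theta.
Variables (G : Group) (I : Type) (A : G -> Prop) (Gs : I -> G -> Prop).

Lemma a3P (B : G -> Prop) : a3_is A B (a3 A B).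
Proof.
apply: epsilon_spec.
have [[[D n] [/= oD n3]]|no] := EM (exists Dn, quot_sub_order A B Dn.1 Dn.2 /\ 3 <= Dn.2).
  have [[D1 n1] /= [oD1 n13] minn] := @ex_minimal _
    (fun Dn => quot_sub_order A B Dn.1 Dn.2 /\ 3 <= Dn.2) snd (ex_intro _ (D, n) (conj oD n3)).
  exists (Some n1); split; first by apply/leP.
  split; first by exists D1.
  by move=> D' m oD' /leP m3; apply/leP; apply: (minn (D', m)).
exists None => D n oD; apply/ltP; rewrite ltnNge; apply/negP => n3.
by apply: no; exists (D, n).
Qed.

Definition theta_num (a : option nat) := if a is Some n then n else 1.
Definition theta_den (a : option nat) := if a is Some n then n - 2 else 1.

Lemma theta_ofE (a : option nat) : (if a is Some n then 3 <= n else true) ->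
  [/\ theta_of a = (INR (theta_num a) / INR (theta_den a))%R, 0 < theta_den a
    & theta_den a <= theta_num a].
Proof.
case: a => [n|] /= n3; last by split=> //; field.
split; [|lia|lia]; rewrite minus_INR //; apply/leP; lia.
Qed.

Lemma a3_ge3 B : if a3 A B is Some n then 3 <= n else true.
Proof. by have := a3P B; case: (a3 A B) => [n|] //= [/leP]. Qed.

Lemma theta_le (a b : option nat) :
  (if a is Some n then 3 <= n else true) -> (if b is Some n then 3 <= n else true) ->
  (theta_of a <= theta_of b)%R <-> theta_num a * theta_den b <= theta_num b * theta_den a.
Proof.
move=> /theta_ofE [-> a0 _] /theta_ofE [-> b0 _].
have ra : (0 < INR (theta_den a))%R by apply: lt_0_INR; apply/ltP.
have rb : (0 < INR (theta_den b))%R by apply: lt_0_INR; apply/ltP.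
have rab := Rmult_lt_0_compat _ _ ra rb.
have ea x : (x * INR (theta_den b) = x / INR (theta_den a) * (INR (theta_den a) * INR (theta_den b)))%R.
  by field; lra.
have eb x : (x * INR (theta_den a) = x / INR (theta_den b) * (INR (theta_den a) * INR (theta_den b)))%R.
  by field; lra.
split=> h.
  by apply/leP/INR_le; rewrite !mult_INR ea eb; apply: Rmult_le_compat_r => //; lra.
apply: (Rmult_le_reg_r _ _ _ rab); rewrite -ea -eb -!mult_INR; apply: le_INR; exact/leP.
Qed.

(** The maximum is attained even for infinite [I]: [n / (n - 2)] decreases and the finite [a_3] have
    a least value. If all are infinite, [i0] serves. *)
Lemma theta_max_spec (i0 : I) : exists p q, [/\ 0 < q, q <= p,
  theta_max A Gs = (INR p / INR q)%R &
  forall i D n, quot_sub_order A (Gs i) D n -> 3 <= n -> q * n <= p * (n - 2)].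
Proof.
have [i1 max1] : exists i1, forall i, (theta_of (a3 A (Gs i)) <= theta_of (a3 A (Gs i1)))%R.
  have [[i [n ai]]|no] := EM (exists i n, a3 A (Gs i) = Some n); last first.
    exists i0 => i; apply/theta_le; try exact: a3_ge3.
    have none j : a3 A (Gs j) = None.
      by case ej: (a3 A (Gs j)) => [n|//]; case: no; exists j, n.
    by rewrite !none.
  have [i1 [n1 a1] min1] := @ex_minimal _ (fun i => exists n, a3 A (Gs i) = Some n)
    (fun i => theta_num (a3 A (Gs i))) (ex_intro _ i (ex_intro _ n ai)).
  exists i1 => j; apply/theta_le; try exact: a3_ge3.
  have := a3_ge3 (Gs i1); have := a3_ge3 (Gs j); rewrite a1.
  case aj: (a3 A (Gs j)) => [k|] /= k3 n3; last by lia.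
  have := min1 j (ex_intro _ k aj); rewrite a1 aj /= => nk.
  by rewrite !mulnBr [k * n1]mulnC; lia.
have : (exists i, theta_of (a3 A (Gs i)) = theta_max A Gs) /\
       forall i, (theta_of (a3 A (Gs i)) <= theta_max A Gs)%R.
  apply: (epsilon_spec (inhabits 1%R) (fun t => (exists i, theta_of (a3 A (Gs i)) = t) /\
              (forall i, (theta_of (a3 A (Gs i)) <= t)%R))).
  by exists (theta_of (a3 A (Gs i1))); split=> //; exists i1.
move=> [[i <-] maxi]; have [et q0 qp] := theta_ofE (a3_ge3 (Gs i)).
exists (theta_num (a3 A (Gs i))), (theta_den (a3 A (Gs i))); split=> // j D n oD n3.
have /(theta_le (a3_ge3 _) (a3_ge3 _)) := maxi j.
have := a3P (Gs j); case: (a3 A (Gs j)) => [k|] /=; last by move=> /(_ _ _ oD) /ltP; rewrite ltnNge n3.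
move=> [/leP k3 [_ /(_ _ _ oD (elimT leP n3)) /leP kn]].
move: (theta_num _) (theta_den _) q0 qp => p q q0 qp le.
(* Going from the order [k] to [n] adds [q (n - k)] on the left and [p (n - k)] on the right. *)
have -> : n = k + (n - k) by lia.
have -> : k + (n - k) - 2 = (k - 2) + (n - k) by lia.
by rewrite !mulnDr; apply: leq_add; [rewrite mulnC | rewrite leq_mul2r qp orbT].
Qed.

End Theta.

(** * The bound for the intersection *)

Section Main.
Variables (G : Group) (T : STree) (act : Action G T).
Hypothesis treeT : is_tree T.
Variables (A : G -> Prop) (ty : V T -> Prop).
Hypotheses (sA : subgroup A) (nA : normal A) (finA : finite_set A).
Hypothesis edgeA : forall g f, A g <-> actE act g f = f.
Hypothesis ty_act : forall g v, ty v -> ty (actV act g v).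
Hypothesis ty_edge : forall f, ty (src f) <-> ~ ty (tgt f).
Hypothesis ty_stab : forall g v, ty v -> actV act g v = v -> A g.
Variables p q : nat.
Hypotheses (q_gt0 : 0 < q) (le_qp : q <= p).
Hypothesis nonty : forall v, ~ ty v -> exists u eps g, [/\ src eps = u, v = actV act g u,
  forall g f, src f = actV act g u -> exists g', f = actE act g' eps &
  forall D n, quot_sub_order A (fun g => actV act g u = u) D n -> 3 <= n -> q * n <= p * (n - 2)].
Variables (H K : G -> Prop) (sH : subgroup H) (sK : subgroup K).
Notation L := (setI H K).
Notation m := (card (setI A (setM H K))).
Let sL := setI_subgroup sH sK.
Variables (WH WK : V T -> Prop).
Hypotheses (mWH : min_inv_subtree act H WH) (mWK : min_inv_subtree act K WK).
Hypothesis hypL : has_hyperbolic act L.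
Variables (lVH lVK : seq (V T)) (lEH lEK : seq (E T)).
Hypothesis lVHP : enumerates (reps (vH act H) WH) lVH.
Hypothesis lVKP : enumerates (reps (vH act K) WK) lVK.
Hypothesis lEHP : enumerates (reps (eH act H) (subtree_edge WH)) lEH.
Hypothesis lEKP : enumerates (reps (eH act K) (subtree_edge WK)) lEK.
Notation WL := (min_core act L).

Let hypH : has_hyperbolic act H. Proof. by case: hypL => g [[Hg _] hg]; exists g. Qed.
Let hypK : has_hyperbolic act K. Proof. by case: hypL => g [[_ Kg] hg]; exists g. Qed.
Let exV : exists v : V T, True.
Proof. by have [[[v _] _] _] := mWH; exists v. Qed.
Let mWL : min_inv_subtree act L WL.
Proof. exact: (min_core_exists treeT ty_act ty_edge exV sL hypL). Qed.
Let WLH x : WL x -> WH x.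
Proof.
by case: mWH => sW [iW _]; apply: min_core_sub sW iW => g [].
Qed.
Let WLK x : WL x -> WK x.
Proof.
by case: mWK => sW [iW _]; apply: min_core_sub sW iW => g [].
Qed.
Let sWH : subtree WH := proj1 mWH.
Let iWH : H_invariant act H WH := proj1 (proj2 mWH).
Let sWK : subtree WK := proj1 mWK.
Let iWK : H_invariant act K WK := proj1 (proj2 mWK).
Let sWL : subtree WL := proj1 mWL.
Let iWL : H_invariant act L WL := proj1 (proj2 mWL).

Lemma min_core_enum : exists lV lE, enumerates (reps (vH act L) WL) lV /\
  enumerates (reps (eH act L) (subtree_edge WL)) lE.
Proof.
have [lE lEP] := edges_finite finA edgeA sH sK iWH iWK WLH WLK lEHP lEKP.
(* A hyperbolic element moves every vertex inside [WL], so each vertex is the source of an edge of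
   [WL] and finiteness carries over from edges. *)
have [lV lVP] : exists l, enumerates (reps (vH act L) WL) l.
  apply: (@enumerates_bounded _ _ (map (fun f => rep (vH act L) (src f)) lE)) => x [Wx rx].
  have [g [Lg hg]] := hypL.
  have [f fx nf] : exists2 f, src f = x & ~ side f (actV act g x).
    by apply: (toward treeT) => e; apply: (hg x).
  have Wt : WL (tgt f) by apply: (subtree_toward treeT sWL _ _ nf); rewrite ?fx //; exact: iWL.
  have fl : rep (eH act L) f \in lE by apply: (rep_lE sL iWL lEP); split; rewrite ?fx.
  apply/mapP; exists (rep (eH act L) f) => //.
  rewrite -(rep_eq (vH_equiv act sL) (eH_src (rep_rel (eH_equiv act sL) f))) fx.
  by rewrite rx.
by exists lV, lE.
Qed.

Lemma tameL : tame act L.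
Proof.
have [lV [lE [lVP lEP]]] := min_core_enum.
right; split=> //; exists WL; split=> //; split.
  exists (size lV); apply/(nclsP (vH_equiv act sL)); last by exists lV.
  by move=> x y Wx [h [Hh <-]]; exact: iWL.
exists (size lE); apply/(nclsP (eH_equiv act sL)); last by exists lE.
exact: (WE_invar iWL).
Qed.

Variables (lVL : seq (V T)) (lEL : seq (E T)).
Hypothesis lVLP : enumerates (reps (vH act L) WL) lVL.
Hypothesis lELP : enumerates (reps (eH act L) (subtree_edge WL)) lEL.
Notation cH v := (contrib act H lEH v).
Notation cK v := (contrib act K lEK v).
Notation cL v := (contrib act L lEL v).

Lemma pair_bound v w : v \in lVH -> w \in lVK ->
  q * \sum_(x <- over_pair act H K lVL v w) cL x <= p * (m * (cH v * cK w)).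
Proof.
move=> vl wl.
have weak s b : s <= b -> q * s <= p * b by move=> sb; exact: leq_mul.
have [dv|nv] := EM (degenerate act H v); have [dw|nw] := EM (degenerate act K w).
- have dv2 := degree_ge2 treeT edgeA ty_act ty_edge sH sWH iWH lVHP lEHP (proj2 (proj2 mWH)) hypH vl dv.
  have dw2 := degree_ge2 treeT edgeA ty_act ty_edge sK sWK iWK lVKP lEKP (proj2 (proj2 mWK)) hypK wl dw.
  have [tv|ntv] := EM (ty v).
    apply: weak.
    apply: (contrib_deg_deg_A treeT finA edgeA sH sK iWH iWK iWL WLH WLK lVHP lVKP lEHP lEKP
      lVLP lELP vl wl dv dw dv2 dw2).
    move=> g x xs gx; apply: (ty_stab _ gx).
    have [_ _ [h [_ hx]] _] := over_pairP sH sK lVLP xs.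
    by apply/(ty_actE ty_act h); rewrite hx.
  (* A vertex [x0] above the pair puts [v] and [w] in one orbit of [G]; [k h^-1] maps [v] to [w],
     which gives the choice of [gw]. *)
  have [[x0 xs0]|no] := EM (exists x, x \in over_pair act H K lVL v w); last first.
    by rewrite big_seq big1 ?muln0 // => x xs; case: no; exists x.
  have [Wx0 _ [h [Hh hx]] [k [Kk kx]]] := over_pairP sH sK lVLP xs0.
  have [u [eps [g [eu vg trans ord]]]] := nonty ntv.
  apply: (contrib_deg_deg_u treeT sA nA finA edgeA sH sK iWH iWK iWL WLH WLK lVHP lVKP lEHP lEKP
    lVLP lELP vl wl dv dw dv2 dw2 eu trans q_gt0 le_qp ord vg (gw := gmul k (gmul (ginv h) g))).
  by rewrite !actVM -vg -hx actVK kx.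
- exact/weak/(contrib_deg_nondeg treeT finA edgeA sH sK iWH iWK iWL WLH WLK
    lVHP lEHP lEKP lVLP lELP vl wl dv nw).
- exact/weak/(contrib_nondeg_deg treeT finA edgeA sH sK iWH iWK iWL WLH WLK
    lVKP lEHP lEKP lVLP lELP vl wl nv dw).
- exact/weak/(contrib_nondeg_nondeg finA edgeA sH sK iWH iWK WLH WLK lEHP lEKP lVLP lELP nv nw).
Qed.

Lemma sum_over_pairs : \sum_(x <- lVL) cL x <=
  \sum_(v <- lVH) \sum_(w <- lVK) \sum_(x <- over_pair act H K lVL v w) cL x.
Proof.
have -> : \sum_(v <- lVH) \sum_(w <- lVK) \sum_(x <- over_pair act H K lVL v w) cL x =
   \sum_(x <- lVL) \sum_(v <- lVH) \sum_(w <- lVK)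
     (if (rep (vH act H) x == v) && (rep (vH act K) x == w) then cL x else 0).
  rewrite [RHS]exchange_big /=; apply: eq_bigr => v _.
  by rewrite [RHS]exchange_big /=; apply: eq_bigr => w _; rewrite big_filter big_mkcond.
apply: leq_sum_seq => x /(proj2 lVLP) [Wx _].
rewrite (big_rem _ (rep_lV sH iWH lVHP (WLH Wx))) /=.
rewrite (big_rem _ (rep_lV sK iWK lVKP (WLK Wx))) /= !eqxx /=.
by rewrite -addnA leq_addr.
Qed.

(** The contributions sum to twice [Cbar_T] for each group: a factor 2 on the left against 4 on the
    right leaves the factor 2. *)
Lemma Cbar_bound_nat : q * Cbar_T act L <= 2 * p * m * Cbar_T act H * Cbar_T act K.
Proof.
have sumL := sum_contrib treeT edgeA ty_act ty_edge sL sWL iWL lVLP lELP (proj2 (proj2 mWL)) hypL.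
have sumH := sum_contrib treeT edgeA ty_act ty_edge sH sWH iWH lVHP lEHP (proj2 (proj2 mWH)) hypH.
have sumK := sum_contrib treeT edgeA ty_act ty_edge sK sWK iWK lVKP lEKP (proj2 (proj2 mWK)) hypK.
have : q * \sum_(x <- lVL) cL x <= p * (m * ((\sum_(v <- lVH) cH v) * (\sum_(w <- lVK) cK w))).
  apply: leq_trans (leq_mul (leqnn q) sum_over_pairs) _.
  rewrite big_distrl !big_distrr /=; apply: leq_sum_seq => v vl.
  by rewrite !big_distrr /=; apply: leq_sum_seq => w wl; exact: pair_bound.
rewrite sumL sumH sumK.
move: (Cbar_T act L) (Cbar_T act H) (Cbar_T act K) => a b c.
have -> : q * (2 * a) = 2 * (q * a) by rewrite mulnCA.
have -> : p * (m * (2 * b * (2 * c))) = 2 * (2 * p * m * b * c).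
  by move: (card _) => m0; lia.
by rewrite leq_pmul2l.
Qed.

End Main.

Theorem theorem3p7
  (G : Group) (T : STree) (act : Action G T)
  (I : Type) (A : G -> Prop) (Gs : I -> G -> Prop)
  (u0 : V T) (u : I -> V T) (e : I -> E T)
  (* T is a tree, G acts on it *)
  (HT : is_tree T)
  (* A is a finite subgroup, normal in G; the G_i are subgroups *)
  (HA : subgroup A) (HAfin : finite_set A) (HAnorm : normal A)
  (HGs : forall i, subgroup (Gs i))
  (* T is the Bass-Serre tree of the tree of groups: the star with centre u0,
     edges e_i = [u0, u_i], is a fundamental domain, with stabilizers
     G_{u0} = A, G_{u_i} = G_i, G_{e_i} = A *)
  (He_src : forall i, src (e i) = u0)
  (He_tgt : forall i, tgt (e i) = u i)
  (Hstab0 : forall g, A g <-> actV act g u0 = u0)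
  (Hstabu : forall i g, Gs i g <-> actV act g (u i) = u i)
  (Hstabe : forall i g, A g <-> actE act g (e i) = e i)
  (Hcovv : forall v, vH act (fun _ => True) u0 v \/
                     exists i, vH act (fun _ => True) (u i) v)
  (Hdisv0 : forall i, ~ vH act (fun _ => True) u0 (u i))
  (Hdisv : forall i j, vH act (fun _ => True) (u i) (u j) -> i = j)
  (Hcove : forall x, exists i, eH act (fun _ => True) (e i) x \/
                               eH act (fun _ => True) (erev (e i)) x)
  (Hdise : forall i j, eH act (fun _ => True) (e i) (e j) -> i = j)
  (Hdise' : forall i j, ~ eH act (fun _ => True) (e i) (erev (e j)))
  (H K : G -> Prop) (HH : subgroup H) (HK : subgroup K)
  (HHt : tame act H) (HKt : tame act K) :
  tame act (setI H K) /\
  (INR (Cbar_T act (setI H K)) <=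
     2 * theta_max A Gs * INR (card (setI A (setM H K)))
       * INR (Cbar_T act H) * INR (Cbar_T act K))%R.
Proof.
pose ty v := vH act (fun _ : G => True) u0 v.
have tr g : (fun _ : G => True) g by [].
have conjA g a : A (gmul (ginv g) (gmul a g)) <-> A a.
  split=> [|/(HAnorm g)//]; move=> /(normal_conj HAnorm g).
  by rewrite -!gmulA gmulgV gmulg1 gmulKg.
have fixE (g h : G) (f : E T) : actE act g (actE act h f) = actE act h f <->
    actE act (gmul (ginv h) (gmul g h)) f = f.
  rewrite !actEM; split=> [->|e1]; first exact: actEK.
  by rewrite -{2}e1 actEKV.
(* Edge stabilizers are conjugates of [A], which is normal. *)
have edgeA g f : A g <-> actE act g f = f.
  have [i [[h [_ <-]]|[h [_ <-]]]] := Hcove f.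
    by rewrite fixE -Hstabe conjA.
  rewrite fixE -(conjA h) (Hstabe i); split=> [e1|e1].
    by rewrite -act_rev e1.
  by rewrite -(rev_invol (e i)) -act_rev e1.
have ty_act g v : ty v -> ty (actV act g v).
  by move=> [h [_ <-]]; exists (gmul g h); rewrite actVM.
have nty g i : ~ ty (actV act g (u i)).
  move=> /(ty_act (ginv g)); rewrite actVK; exact: Hdisv0.
have ty0 g : ty (actV act g u0) by exists g.
have ty_edge f : ty (src f) <-> ~ ty (tgt f).
  have [i [[h [_ <-]]|[h [_ <-]]]] := Hcove f; rewrite !(act_src, act_tgt).
    rewrite He_src He_tgt; split=> // _; exact: nty.
  rewrite tgt_rev -/(tgt (e i)) He_src He_tgt; split; first by move=> /nty.
  by move=> n; case: n.
have ty_stab g v : ty v -> actV act g v = v -> A g.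
  move=> [h [_ <-]] gh; apply/(conjA h)/Hstab0; rewrite !actVM gh; exact: actVK.
have exV : exists v : V T, True by exists u0.
have sL := setI_subgroup HH HK.
(* [theta_max] is specified only for nonempty [I]; a moved vertex has an edge, and this edge yields
   an index. *)
have hyp_index (M : G -> Prop) : has_hyperbolic act M -> exists i : I, True.
  move=> [g [_ hg]].
  have [f _ _] : exists2 f, src f = u0 & ~ side f (actV act g u0).
    by apply: (toward HT) => e1; apply: (hg u0).
  by have [i _] := Hcove f; exists i.
have Cbar0 (M : G -> Prop) : ~ has_hyperbolic act M -> Cbar_T act M = 0.
  by rewrite /Cbar_T /C_T; case: excluded_middle_informative.
have [hypL|nhypL] := EM (has_hyperbolic act (setI H K)); last first.
  split; first by left; exact: (elliptic_fixes HT HA edgeA u0 sL).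
  rewrite (Cbar0 _ nhypL) /=.
  (* The left side is 0, but the right side must be shown nonnegative: either [Cbar_T] of [H]
     vanishes, or an index exists and [theta_max] is a genuine fraction. *)
  have [hypH|/Cbar0 ->] := EM (has_hyperbolic act H); last by rewrite /=; lra.
  have [i0 _] := hyp_index _ hypH.
  have [p [q [q0 qp -> _]]] := theta_max_spec A Gs i0.
  do !apply: Rmult_le_pos; try exact: pos_INR; first by lra.
  by apply/Rlt_le/Rinv_0_lt_compat/lt_0_INR/ltP.
have nofix M : has_hyperbolic act M -> ~ fixes_vertex act M.
  by move=> [g [Mg hg]] [v /(_ _ Mg)]; exact: hg.
have hypH : has_hyperbolic act H by case: hypL => g [[Hg _] hg]; exists g.
have hypK : has_hyperbolic act K by case: hypL => g [[_ Kg] hg]; exists g.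
have data (M : G -> Prop) : subgroup M -> has_hyperbolic act M -> tame act M ->
  exists W lV lE, [/\ min_inv_subtree act M W, enumerates (reps (vH act M) W) lV &
    enumerates (reps (eH act M) (subtree_edge W)) lE].
  move=> sM hM [/(nofix _ hM)//|[_ [W [mW [[n nV] [k nE]]]]]].
  have iW : H_invariant act M W by case: mW => _ [].
  have /(nclsP (vH_equiv act sM)) [|lV lVP _] := nV.
    by move=> x y Wx [h [Mh <-]]; exact: iW.
  have /(nclsP (eH_equiv act sM)) [|lE lEP _] := nE; first exact: (WE_invar iW).
  by exists W, lV, lE.
have [WH [lVH [lEH [mWH lVHP lEHP]]]] := data _ HH hypH HHt.
have [WK [lVK [lEK [mWK lVKP lEKP]]]] := data _ HK hypK HKt.
split; first exact: (tameL HT HAfin edgeA ty_act ty_edge HH HK mWH mWK hypL lEHP lEKP).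
have [i0 _] := hyp_index _ hypH.
have [p [q [q0 qp -> ord]]] := theta_max_spec A Gs i0.
have [lVL [lEL [lVLP lELP]]] :=
  min_core_enum HT HAfin edgeA ty_act ty_edge HH HK mWH mWK hypL lEHP lEKP.
have nonty v : ~ ty v -> exists u eps g, [/\ src eps = u, v = actV act g u,
    forall g f, src f = actV act g u -> exists g', f = actE act g' eps &
    forall D n, quot_sub_order A (fun g => actV act g u = u) D n -> 3 <= n -> q * n <= p * (n - 2)].
  move=> nv; have [//|[i [g [_ gv]]]] := Hcovv v.
  (* The base edge has to start at [u i], hence the reversed edge. *)
  exists (u i), (erev (e i)), g; split=> //; first exact: He_tgt.
    move=> g' f fs; have [j [[h [_ hf]]|[h [_ hf]]]] := Hcove f.
      by case: (@nty g' i); rewrite -fs -hf act_src He_src.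
    have ij : i = j.
      apply: Hdisv; exists (gmul (ginv h) g'); split=> //.
      by rewrite actVM -fs -hf act_src -/(tgt (e j)) He_tgt actVK.
    by exists h; rewrite ij.
  have -> : (fun g => actV act g (u i) = u i) = Gs i.
    by apply/funext => x; apply/propext; rewrite Hstabu.
  exact: ord.
have := Cbar_bound_nat HT HA HAnorm HAfin edgeA ty_act ty_edge ty_stab q0 qp nonty HH HK
  mWH mWK hypL lVHP lVKP lEHP lEKP lVLP lELP.
move: (card _) (Cbar_T act (setI H K)) (Cbar_T act H) (Cbar_T act K) => m a b c le.
have rq : (0 < INR q)%R by apply/lt_0_INR/ltP.
apply: (Rmult_le_reg_l _ _ _ rq).
have -> : (INR q * (2 * (INR p / INR q) * INR m * INR b * INR c) = 2 * INR p * INR m * INR b * INR c)%R.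
  by field; lra.
have -> : 2%R = INR 2 by [].
by rewrite -!mult_INR; apply: le_INR; apply/leP.
Qed.
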